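(* There exist universal constants $c_1,c_2>0$ such that the following holds for all $n\ge c_1$ and $\alpha\in(0,0.5)$. Consider any number $k\le0.1\,n$ such that $\eta=c_2\log(n/\alpha)\big((k/n)\vee n^{-1/6}\big)\le0.05$. Then $$\mathbf I(\mathrm{BH}_\alpha(\widetilde\theta,\widetilde\sigma),k)\le\alpha(1+\eta)+e^{-n^{1/2}},$$ $$\mathbf{II}(\mathrm{BH}_\alpha(\widetilde\theta,\widetilde\sigma),k,\alpha(1-\eta))\le e^{-n^{1/2}},$$ where $\widetilde\theta=Y_{(\lceil n/2\rceil)}$ and $\widetilde\sigma=U_{(\lceil n/2\rceil)}/\overline\Phi^{-1}(1/4)$ with $U_i=|Y_i-Y_{(\lceil n/2\rceil)}|$.
   Context: Notation: $x\vee y=\max(x,y)$; $\overline\Phi$ is the upper tail function of $\mathcal N(0,1)$; $v_{(i)}$ is the $i$-th smallest entry of a vector $v$. Setting. One observes $Y=(Y_1,\dots,Y_n)$ with independent real coordinates, $Y_i\sim P_i$, and $P=\otimes_{i=1}^nP_i$ is the law of $Y$. $\mathcal P$ is the set of all such product distributions $P$ on $\mathbb R^n$ for which there exists $(\theta,\sigma)\in\mathbb R\times(0,\infty)$ with $|\{i: P_i=\mathcal N(\theta,\sigma^2)\}|>n/2$; this couple is unique and denoted $(\theta(P),\sigma(P))$. Let $\mathcal H_0(P)=\{i: P_i=\mathcal N(\theta(P),\sigma(P)^2)\}$ (true nulls), $\mathcal H_1(P)$ the complement of $\mathcal H_0(P)$ in $\{1,\dots,n\}$, $n_1(P)=|\mathcal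 H_1(P)|$. A multiple testing procedure is a measurable map $R$ from the data $Y$ to subsets $R(Y)\subset\{1,\dots,n\}$ (rejected hypotheses). Set $$\mathrm{FDP}(P,R(Y))=\frac{|R(Y)\cap\mathcal H_0(P)|}{|R(Y)|\vee1},\quad \mathrm{FDR}(P,R)=\mathbb E_{Y\sim P}[\mathrm{FDP}(P,R(Y))],\quad \mathrm{TDP}(P,R(Y))=\frac{|R(Y)\cap\mathcal H_1(P)|}{n_1(P)\vee1}.$$ Plug-in BH. For $u\in\mathbb R$, $s>0$, let $p_i(u,s)=2\overline\Phi(|Y_i-u|/s)$, $T_\alpha(Y;u,s)=\max\{t\in[0,1]:\sum_{i=1}^n\mathbf 1\{p_i(u,s)\le t\}\ge nt/\alpha\}$ and $\mathrm{BH}_\alpha(u,s)=\mathrm{BH}_\alpha(Y;u,s)=\{i: p_i(u,s)\le T_\alpha(Y;u,s)\}$. The oracle BH procedure is $\mathrm{BH}^*_\alpha=\mathrm{BH}_\alpha(Y;\theta(P),\sigma(P))$. Risks, for a sparsity parameter $k>0$: $\mathbf I(R,k)=\sup_{P\in\mathcal P,\,n_1(P)\le k}\mathrm{FDR}(P,R)$ and $\mathbf{II}(R,k,\alpha)=\sup_{P\in\mathcal P,\,n_1(P)\le k}\mathbb P_{Y\sim P}\big(\mathrm{TDP}(P,R)<\mathrm{TDP}(P,\mathrm{BH}^*_\alpha)\big)$. *)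

(* Defs.v *)
From HB Require Import structures.
From mathcomp Require Import all_boot all_order all_algebra.
From mathcomp Require Import all_classical all_reals all_analysis.
From mathcomp Require Import measurable_realfun.

Set Implicit Arguments.
Unset Strict Implicit.
Unset Printing Implicit Defensive.

Import Order.TTheory GRing.Theory Num.Theory.
Import numFieldNormedType.Exports.

Local Open Scope classical_set_scope.
Local Open Scope ring_scope.

Section gaussian_tail.
Context {R : realType}.

Definition gauss_tail (x : R) : R := fine (normal_prob (0 : R) 1 `]x, +oo[).

(* [gauss_tail] is strictly decreasing with range ]0, 1[, so the preimage of
   any q in ]0, 1[ exists and is unique; 0 is a default value elsewhere. *)
Definition gauss_tail_inv (q : R) : R := xget 0 [set x | gauss_tail x = q].

Lemma measurable_gauss_tail : measurable_fun [set: R] gauss_tail.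
Proof.
apply: nonincreasing_measurable => //= r s rs.
rewrite /gauss_tail fine_le ?fin_num_measure//.
by apply: le_measure; rewrite ?inE//; apply: subset_itvr; rewrite bnd_simp.
Qed.

Lemma measurable_invr : measurable_fun [set: R] (fun x : R => x^-1).
Proof.
have -> : (fun x : R => x^-1) = (fun x => x * (x ^+ 2) `^ (-1)).
  apply/funext => x; rewrite powR_inv1 ?sqr_ge0//.
  have [->|x0] := eqVneq x 0; first by rewrite invr0 mul0r.
  by rewrite expr2 invfM mulrA divff ?mul1r.
apply: measurable_funM => //.
by apply: (measurableT_comp (measurable_powR _)); exact: exprn_measurable.
Qed.

End gaussian_tail.

Section greatest.
Context {R : realType}.

(* The greatest element of A; 0 is a default value when there is none. *)
Definition set_max (A : set R) : R := xget 0 (A `&` ubound A).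

Lemma set_maxE (A : set R) x : A x -> ubound A x -> set_max A = x.
Proof.
move=> Ax ubx; rewrite /set_max; case: xgetP => [y _ [Ay uby]|/(_ x) []//].
by apply/eqP; rewrite eq_le ubx//= uby.
Qed.

End greatest.

(* v_(i), the i-th smallest entry of v, counted from i = 1. *)
Definition order_stat {R : realType} (v : seq R) (i : nat) : R :=
  nth 0 (sort <=%R v) i.-1.

Lemma order_stat_le {R : realType} (v : seq R) (i : nat) (t : R) :
  (0 < i <= size v)%N ->
  (order_stat v i <= t) = (i <= count (fun x : R => (x <= t)%R) v)%N.
Proof.
case: i => // i /andP[_ iv]; rewrite /order_stat /=.
rewrite -(count_sort <=%R _ v).
rewrite -(size_sort <=%R v) in iv.
have := sort_sorted (@le_total _ R) v.
elim: (sort _ _) i iv => //= x s IH i iv px.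
have xs : all (fun y => x <= y) s by exact: order_path_min (@le_trans _ _) px.
case: (leP x t) => [xt|tx]; case: i iv => [|i] /= iv.
- by rewrite xt.
- by rewrite IH ?(path_sorted px).
- rewrite add0n leNgt tx /=; apply/esym/negbTE; rewrite -leqNgt leqn0.
  rewrite (eq_in_count (a2 := pred0)) ?count_pred0// => y /(allP xs) xy /=.
  by rewrite leNgt (lt_le_trans tx xy).
- rewrite leNgt (lt_le_trans tx) /=; last by apply/(allP xs)/mem_nth.
  apply/esym/negbTE; rewrite -leqNgt add0n.
  rewrite (eq_in_count (a2 := pred0)) ?count_pred0// => y /(allP xs) xy /=.
  by rewrite leNgt (lt_le_trans tx xy).
Qed.

Lemma measurable_set_valued d (T : measurableType d) (n : nat)
    (F : T -> {set 'I_n}) :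
  (forall i, measurable [set y | i \in F y]) ->
  forall Q : pred {set 'I_n}, measurable [set y | Q (F y)].
Proof.
move=> mF Q.
have -> : [set y | Q (F y)] = \bigcup_(S in [set S : {set 'I_n} | Q S])
    \bigcap_(i in [set: 'I_n]) [set y | (i \in F y) = (i \in S)].
  apply/seteqP; split => [y Qy|y [S QS FS]]; first by exists (F y).
  by rewrite /= (_ : F y = S)//; apply/setP => i; exact: FS.
apply: fin_bigcup_measurable => // S _.
apply: fin_bigcap_measurable => // i _.
case: (i \in S); first exact: mF.
rewrite (_ : [set y | _] = ~` [set y | i \in F y]); first exact: measurableC.
by apply/seteqP; split => y /=; [move=> -> | move/negP/negbTE].
Qed.


Lemma measurable_fun_le d (T : measurableType d) {R : realType} (f : T -> R) :
  (forall t, measurable [set y | f y <= t]) -> measurable_fun [set: T] f.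
Proof.
move=> mf; apply: (measurability (@RGenOInfty.G R)).
  exact: RGenOInfty.measurableE.
move=> _ [_ [t ->]] <-; rewrite setTI.
rewrite (_ : _ @^-1` _ = ~` [set y | f y <= t]); first exact: measurableC.
by apply/seteqP; split => y /=; rewrite in_itv/= andbT ltNge => /negP.
Qed.

Lemma measurable_le_cst d (T : measurableType d) {R : realType} (f : T -> R) t :
  measurable_fun [set: T] f -> measurable [set y | f y <= t].
Proof.
move=> mf; rewrite (_ : [set y | _] = setT `&` f @^-1` `]-oo, t]).
  exact: mf.
by apply/seteqP; split => y /=; rewrite in_itv//= => -[].
Qed.

Lemma measurable_order_stat {R : realType} n (i : nat) :
  measurable_fun [set: n.-tuple R] (fun y : n.-tuple R => order_stat y i).
Proof.
have [iN|iN] := ltnP i.-1 n; last first.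
  rewrite (_ : (fun _ => _) = cst 0)//; apply/funext => y.
  by rewrite /order_stat nth_default// size_sort size_tuple.
rewrite (_ : (fun _ => _) = (fun y : n.-tuple R => order_stat y i.-1.+1))//.
apply: measurable_fun_le => t.
rewrite (_ : [set y | _] = [set y : n.-tuple R |
    (i.-1 < #|[set j | (tnth y j <= t)%R]%SET|)%N]).
  apply: (measurable_set_valued (F := fun y : n.-tuple R =>
    [set j | (tnth y j <= t)%R]%SET) _ (fun S => i.-1 < #|S|)%N) => j.
  rewrite (_ : [set y | _] = [set y : n.-tuple R | tnth y j <= t]).
    by apply: measurable_le_cst; exact: measurable_tnth.
  by apply/seteqP; split => y /=; rewrite inE.
apply/seteqP; split => y /=; rewrite order_stat_le ?size_tuple//;
  by rewrite -sum1_count -sum1dep_card big_tuple.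
Qed.

Section benjamini_hochberg.
Context {R : realType} {n : nat}.
Implicit Types (p : 'I_n -> R) (y : n.-tuple R).

Definition bh_threshold (alpha : R) p : R :=
  set_max [set t | 0 <= t <= 1 /\
                   n%:R * t / alpha <= (\sum_(i < n) (p i <= t)%R)%:R].

Definition bh_rejection (alpha : R) p : {set 'I_n} :=
  [set i | p i <= bh_threshold alpha p]%SET.

Definition pvalue y (u s : R) (i : 'I_n) : R :=
  2 * gauss_tail (`|tnth y i - u| / s).

Definition BH (alpha : R) y (u s : R) : {set 'I_n} :=
  bh_rejection alpha (pvalue y u s).

Let step (alpha : R) (m : nat) : R := Num.min 1 (alpha * m%:R / n%:R).

Let cnt p (t : R) : nat := #|[set i | p i <= t]%SET|.

Let cntE p t : (\sum_(i < n) (p i <= t)%R)%N = cnt p t.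
Proof. by rewrite /cnt -sum1dep_card [RHS]big_mkcond. Qed.

Lemma bh_threshold_le0 alpha p : alpha <= 0 -> bh_threshold alpha p = 1.
Proof.
move=> a0; apply: set_maxE => [|t []/andP[]//].
split; first by rewrite ler01 lexx.
by rewrite (@le_trans _ _ 0)// mulr1 mulr_ge0_le0// invr_le0.
Qed.

Lemma in_bh_rejection alpha p i : 0 < alpha ->
  (i \in bh_rejection alpha p) =
  [exists m : 'I_n.+1, (p i <= step alpha m) && (m <= cnt p (step alpha m))%N].
Proof.
move=> a0; have n0 : (0 : R) < n%:R.
  by rewrite ltr0n; case: (n) i => // -[].
have step_mono m1 m2 : (m1 <= m2)%N -> step alpha m1 <= step alpha m2.
  move=> m12; rewrite /step le_min ge_min lexx/= ge_min.
  by rewrite ler_pM2r ?invr_gt0// ler_pM2l// ler_nat m12 orbT.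
pose P (m : 'I_n.+1) := (m <= cnt p (step alpha m))%N.
have [m Pm mmax] : {m : 'I_n.+1 | P m & forall j : 'I_n.+1, P j -> (j <= m)%N}.
  by case: (@arg_maxnP _ ord0 P val) => // m Pm mmax; exists m.
suff E : bh_threshold alpha p = step alpha m.
  rewrite inE E; apply/idP/existsP => [pim|[j /andP[pj Pj]]].
    by exists m; apply/andP.
  exact/(le_trans pj)/step_mono/mmax.
apply: set_maxE => [|t [/andP[t0 t1]]].
  split.
    rewrite /step le_min ler01 ge_min lexx andbT/=.
    by rewrite divr_ge0 ?mulr_ge0// ?ltW.
  rewrite cntE (@le_trans _ _ m%:R)// ?ler_nat//.
  rewrite ler_pdivrMr// mulrC -ler_pdivlMr// [m%:R * _]mulrC.
  by rewrite /step ge_min lexx orbT.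
rewrite cntE => tcnt.
have cntn : (cnt p t < n.+1)%N by rewrite ltnS -[X in (_ <= X)%N]card_ord max_card.
have tstep : t <= step alpha (cnt p t).
  rewrite /step le_min t1/= ler_pdivlMr// mulrC.
  by move: tcnt; rewrite ler_pdivrMr// [_ * alpha]mulrC.
apply: (le_trans tstep); apply/step_mono/(mmax (Ordinal cntn)) => /=.
rewrite /P/=; apply/subset_leq_card/fintype.subsetP => j; rewrite !inE => /le_trans.
exact.
Qed.

Lemma measurable_pvalue d (T : measurableType d) (f : T -> n.-tuple R)
    (u s : T -> R) (i : 'I_n) :
  measurable_fun [set: T] f -> measurable_fun [set: T] u ->
  measurable_fun [set: T] s ->
  measurable_fun [set: T] (fun w => pvalue (f w) (u w) (s w) i).
Proof.
move=> mf mu ms; apply: measurable_funM => //.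
apply: (measurableT_comp measurable_gauss_tail).
apply: measurable_funM; last exact: (measurableT_comp measurable_invr).
apply: (measurableT_comp (@normr_measurable R setT)).
apply: measurable_funB => //.
exact: (measurableT_comp (measurable_tnth i)).
Qed.

Lemma measurable_bh_rejection d (T : measurableType d) (q : T -> 'I_n -> R)
    (alpha : R) : (forall i, measurable_fun [set: T] (q ^~ i)) ->
  forall S : {set 'I_n},
    measurable ((fun w => bh_rejection alpha (q w)) @^-1` [set S]).
Proof.
move=> mq S; rewrite (_ : _ @^-1` _ =
    [set w | pred1 S (bh_rejection alpha (q w))]); last first.
  by apply/seteqP; split => w /= /eqP.
apply: measurable_set_valued => i.
have [a0|a0] := leP alpha 0.
  rewrite (_ : [set w | _] = [set w | q w i <= 1]).
    exact: measurable_le_cst.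
  by apply/seteqP; split => w /=; rewrite inE bh_threshold_le0.
rewrite (_ : [set w | _] = \bigcup_(m in [set: 'I_n.+1])
    ([set w | q w i <= step alpha m] `&`
     [set w | (m <= cnt (q w) (step alpha m))%N])).
  apply: fin_bigcup_measurable => // m _.
  apply: measurableI; first exact: measurable_le_cst.
  apply: (measurable_set_valued (F := fun w =>
    [set j | q w j <= step alpha m]%SET) _ (fun S => m <= #|S|)%N) => j.
  rewrite (_ : [set w | _] = [set w | q w j <= step alpha m]).
    exact: measurable_le_cst.
  by apply/seteqP; split => w /=; rewrite inE.
apply/seteqP; split => w /=; rewrite in_bh_rejection//.
  by move=> /existsP[m /andP[? ?]]; exists m.
by move=> [m _ [? ?]]; apply/existsP; exists m; apply/andP.
Qed.

End benjamini_hochberg.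

(* A multiple testing procedure: a measurable map from R^n to the subsets of
   {0, ..., n.-1}. *)
Record mtp (R : realType) (n : nat) := Mtp {
  mtp_fun :> n.-tuple R -> {set 'I_n};
  mtp_measurable : forall S : {set 'I_n}, measurable (mtp_fun @^-1` [set S])
}.

(* The plug-in BH procedure, with data-dependent location u and scale s. *)
Program Definition BH_mtp {R : realType} {n : nat} (alpha : R)
    (u s : {mfun n.-tuple R >-> R}) : mtp R n :=
  @Mtp R n (fun y => BH alpha y (u y) (s y)) _.
Next Obligation.
move=> R n alpha u s S; apply: measurable_bh_rejection => i.
by apply: measurable_pvalue.
Qed.

Section estimators.
Context {R : realType} {n : nat}.
Implicit Type y : n.-tuple R.

(* [uphalf n] is the ceiling of n / 2. *)
Definition theta_tilde y : R := order_stat y (uphalf n).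

Definition sigma_tilde y : R :=
  order_stat [tuple `|tnth y i - theta_tilde y| | i < n] (uphalf n)
  / gauss_tail_inv (1 / 4).

Lemma measurable_theta_tilde : measurable_fun [set: n.-tuple R] theta_tilde.
Proof. exact: measurable_order_stat. Qed.

Lemma measurable_sigma_tilde : measurable_fun [set: n.-tuple R] sigma_tilde.
Proof.
apply: measurable_funM => //.
apply: (measurableT_comp (@measurable_order_stat R n (uphalf n))).
apply/measurable_fun_tnthP => i; rewrite (_ : _ \o _ =
    fun y => `|tnth y i - theta_tilde y|); last first.
  by apply/funext => y /=; rewrite tnth_mktuple.
apply: (measurableT_comp (@normr_measurable R setT)).
apply: measurable_funB; [exact: measurable_tnth|exact: measurable_theta_tilde].
Qed.

HB.instance Definition _ := isMeasurableFun.Build _ _ _ _ theta_tilde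
  measurable_theta_tilde.

HB.instance Definition _ := isMeasurableFun.Build _ _ _ _ sigma_tilde
  measurable_sigma_tilde.

End estimators.

Section model.
Context {R : realType} {n : nat}.
Implicit Types (P : probability (n.-tuple R) R) (A : {set 'I_n}).

Definition marginal P (i : 'I_n) : set R -> \bar R :=
  pushforward P (fun y : n.-tuple R => tnth y i).

(* P is the product of its marginals, i.e. the coordinates are independent. *)
Definition product_law P : Prop :=
  forall B : 'I_n -> set R, (forall i, measurable (B i)) ->
    P [set y | forall i, B i (tnth y i)] = (\prod_(i < n) marginal P i (B i))%E.

(* Laws are compared on measurable sets only, measures having no prescribed
   value on the others. The second parameter of [normal_prob] is the standard
   deviation. *)
Definition gaussian_coords P (theta sigma : R) : {set 'I_n} :=
  [set i | `[< forall B : set R, measurable B ->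
                 marginal P i B = normal_prob theta sigma B >]]%SET.

Definition null_param P (ts : R * R) : Prop :=
  0 < ts.2 /\ n%:R / 2 < #|gaussian_coords P ts.1 ts.2|%:R :> R.

(* The class of product laws on R^n more than half of whose marginals are one
   and the same nondegenerate Gaussian. *)
Definition contaminated_law P : Prop :=
  product_law P /\ exists ts : R * R, null_param P ts.

(* The parameters (theta(P), sigma(P)) of the null, unique for a law in the
   class above; (0, 1) is a default value elsewhere. *)
Definition null_theta_sigma P : R * R := xget (0, 1) [set ts | null_param P ts].

Definition null_theta P : R := (null_theta_sigma P).1.
Definition null_sigma P : R := (null_theta_sigma P).2.

Definition H0 P : {set 'I_n} := gaussian_coords P (null_theta P) (null_sigma P).
Definition H1 P : {set 'I_n} := (~: H0 P)%SET.
Definition n1 P : nat := #|H1 P|.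

Definition FDP P A : R := #|A :&: H0 P|%:R / (maxn #|A| 1)%:R.
Definition TDP P A : R := #|A :&: H1 P|%:R / (maxn (n1 P) 1)%:R.

Definition FDR P (rej : mtp R n) : \bar R := ('E_P[fun y => FDP P (rej y)])%E.

Definition BH_oracle (alpha : R) P : mtp R n :=
  BH_mtp alpha (cst (null_theta P)) (cst (null_sigma P)).

Definition sparse_laws (k : R) : set (probability (n.-tuple R) R) :=
  [set P | contaminated_law P /\ (n1 P)%:R <= k].

Definition riskI (rej : mtp R n) (k : R) : \bar R :=
  ereal_sup [set FDR P rej | P in sparse_laws k].

Definition riskII (rej : mtp R n) (k alpha : R) : \bar R :=
  ereal_sup
    [set P [set y | TDP P (rej y) < TDP P (BH_oracle alpha P y)]
       | P in sparse_laws k].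

End model.

(* Main.v *)
Require Import Defs.
From mathcomp Require Import all_boot all_order all_algebra.
From mathcomp Require Import all_classical all_reals all_analysis.
From mathcomp Require Import measurable_realfun.
From mathcomp Require Import ring lra zify.

(** Both risks are controlled on one event of probability at least
    [1 - expR (- sqrt n)], where the median and the rescaled median absolute
    deviation are within a relative error [d] of the null parameters, [d]
    being of order [max (k / n) (n ^ (- 1 / 6))] ([good_sample_estimators]).
    Since more than half of the coordinates are null, both medians are located
    by events that hold for a majority of the coordinates, whatever the
    nonnull coordinates do; a Chernoff bound for the null coordinates shows
    that these majorities hold ([majority_tail], [bad_sample_tail]).

    An error [d] on the parameters moves a Gaussian quantile [z] by
    [d * (1 + z)], and by the Mills ratio changes its tail by a relative error
    [d * (1 + z) ^ 2] ([gauss_tail_ratio_left], [gauss_tail_ratio_right]). The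
    procedure only compares p-values with levels [alpha * r / n], [r >= 1], at
    which [z ^ 2] is at most of order [ln (n / alpha)]; this gives the rate
    [eta].

    Power. The rejection set is the largest set [S] whose p-values are at most
    [alpha * #|S| / n] ([bh_self_consistent], [bh_maximal]). The oracle set at
    level [alpha * (1 - eta)] has this property for the plug-in p-values, so
    it is contained in the plug-in set ([oracle_sub_plugin]).

    False discoveries. The plug-in p-values are not independent, since each
    uses all of the data. But a rejected coordinate has a p-value below 1/2,
    so it is farther from the median than the median deviation, and moving it
    on its own side without changing its rejection affects neither median,
    hence neither the estimators nor the number [r] of rejections
    ([BH_leave_one_out]). With the other coordinates fixed, each side of the
    median therefore contributes to the false discovery rate at most [r^-1]
    times the null mass of a tail of nominal level [alpha * r / (2 * n)], that
    is [alpha * (1 + eta) / (2 * n)] ([fdp_term_side], [fdp_term_integral]);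
    coordinates are fixed by means of [resample_integral]. Summing over the
    two sides and over the null coordinates gives [alpha * (1 + eta)]
    ([FDR_plugin_le]). *)

Import Order.TTheory GRing.Theory Num.Theory.
Import numFieldNormedType.Exports.

Set Implicit Arguments.
Unset Strict Implicit.
Unset Printing Implicit Defensive.

Local Open Scope classical_set_scope.
Local Open Scope ring_scope.

(** * The Gaussian tail *)

Section gaussian.
Context {R : realType}.
Implicit Types (x y z th s : R).
Local Notation mu := (@lebesgue_measure R).
Local Notation phi := (@normal_pdf R 0 1).
Local Notation T := (@gauss_tail R).

Lemma std_normal_pdfE x : phi x = normal_peak 1 * expR (- (x ^+ 2) / 2).
Proof. by rewrite normal_pdfE ?oner_neq0// /normal_fun subr0 expr1n. Qed.

Lemma normal_pdf_affine th s x : 0 < s ->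
  normal_pdf th s (th + s * x) * s = phi x.
Proof.
move=> s0; have sn0 : s != 0 by rewrite gt_eqF.
rewrite std_normal_pdfE normal_pdfE// /normal_fun /normal_peak.
have -> : - (th + s * x - th) ^+ 2 / (s ^+ 2 *+ 2) = - (x ^+ 2) / 2.
  by rewrite -mulr_natr; field.
rewrite mulrAC; congr (_ * _).
rewrite -[s ^+ 2 * pi *+ 2]mulrnAr sqrtrM ?sqr_ge0// sqrtr_sqr gtr0_norm//.
by rewrite expr1n mul1r invfM mulrAC mulVf ?mul1r.
Qed.

Lemma continuous_affine th s : continuous (fun x : R => th + s * x).
Proof.
move=> x; apply: cvgD; first exact: cvg_cst.
by apply: cvgM; [exact: cvg_cst|exact: cvg_id].
Qed.

(** Substitution along the affine map sending the standard law to the law with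
    mean [th] and deviation [s]: every null tail is a value of [gauss_tail]. *)
Lemma normal_prob_standardize th s x : 0 < s ->
  normal_prob th s `[th + s * x, +oo[ = normal_prob 0 1 `[x, +oo[.
Proof.
move=> s0; pose F y := th + s * y.
have F' : (F^`())%classic = cst s.
  apply/funext => y; rewrite derive1E deriveD// derive_cst add0r.
  by rewrite deriveM// derive_id derive_cst scaler0 addr0 /GRing.scale/= mulr1.
have dF y : derivable F y 1 by rewrite /F; exact: ex_derive.
rewrite /normal_prob (@increasing_ge0_integration_by_substitutiony _ F) //.
- apply: eq_integral => y _; congr (_%:E).
  by rewrite F' /= -(normal_pdf_affine th y s0).
- by move=> u v _ _ uv; rewrite /F ltrD2l ltr_pM2l.
- by rewrite F' => ? _; exact: cst_continuous.
- by rewrite F'; exact: is_cvg_cst.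
- by rewrite F'; exact: is_cvg_cst.
- split=> //; apply: cvg_at_right_filter; exact: continuous_affine.
- rewrite /F; apply/cvgryPge => A; exists (s^-1 * (A - th)); split=> [|y /ltW].
    exact: num_real.
  by rewrite ler_pdivrMl// lerBlDl.
- apply: continuous_subspaceT; apply: continuous_normal_pdf; exact: lt0r_neq0.
- by move=> y _; exact: normal_pdf_ge0.
Qed.

Lemma normal_prob_fin th s (A : set R) : measurable A ->
  normal_prob th s A = (fine (normal_prob th s A))%:E.
Proof. by move=> mA; rewrite fineK// fin_num_measure. Qed.

Lemma normal_prob_obnd_cbnd th s x :
  normal_prob th s `]x, +oo[ = normal_prob th s `[x, +oo[.
Proof.
apply: integral_itv_obnd_cbnd; apply: measurable_funTS.
by apply/measurable_EFinP; exact: measurable_normal_pdf.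
Qed.

Lemma normal_prob_bndo_bndc th s x :
  normal_prob th s `]-oo, x[ = normal_prob th s `]-oo, x].
Proof.
apply: integral_itv_bndo_bndc; apply: measurable_funTS.
by apply/measurable_EFinP; exact: measurable_normal_pdf.
Qed.

Lemma normal_prob_right th s x : 0 < s ->
  normal_prob th s `]th + s * x, +oo[ = (T x)%:E.
Proof.
move=> s0; rewrite normal_prob_obnd_cbnd normal_prob_standardize//.
by rewrite -normal_prob_obnd_cbnd /gauss_tail -normal_prob_fin.
Qed.

Lemma normal_prob_left th s x : 0 < s ->
  normal_prob th s `]-oo, th - s * x[ = (T x)%:E.
Proof.
move=> s0; rewrite normal_prob_bndo_bndc -(normal_prob_right (- th) x s0).
rewrite normal_prob_obnd_cbnd /normal_prob.
rewrite -[th - s * x]opprK ge0_integration_by_substitutionNy; last 2 first.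
- apply: continuous_subspaceT; apply: continuous_normal_pdf; exact: lt0r_neq0.
- by move=> y _; exact: normal_pdf_ge0.
have -> : - (th - s * x) = - th + s * x by ring.
apply: eq_integral => y _; congr (_%:E) => /=.
rewrite !normal_pdfE ?lt0r_neq0// /normal_fun.
have -> : - y - th = - (y - - th) by ring.
by rewrite sqrrN.
Qed.

Lemma gauss_tailN x : T (- x) = 1 - T x.
Proof.
apply: EFin_inj; rewrite EFinB -(normal_prob_right 0 _ ltr01).
rewrite -(normal_prob_left 0 x ltr01) normal_prob_bndo_bndc mul1r add0r sub0r.
by rewrite mul1r -setCitvl probability_setC.
Qed.

Lemma gauss_tail_diff x y : x <= y ->
  (T x - T y)%:E = (\int[mu]_(t in `]x, y]) (phi t)%:E)%E.
Proof.
move=> xy; rewrite EFinB -(normal_prob_right 0 _ ltr01).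
rewrite -(normal_prob_right 0 y ltr01) !add0r !mul1r.
have -> : `]x, +oo[%classic = `]x, y] `|` `]y, +oo[.
  by rewrite -(@itv_bndbnd_setU _ _ _ (BRight y))// bnd_simp.
rewrite measureU//; last first.
  apply/seteqP; split => t //= -[]; rewrite !in_itv/= => /andP[_ ty] /andP[yt _].
  by rewrite ltNge ty in yt.
by rewrite addeK// fin_num_measure.
Qed.

Lemma integral_itv_cst x y r : x <= y ->
  (\int[mu]_(t in `]x, y]) (cst r%:E) t)%E = (r * (y - x))%:E.
Proof.
move=> xy; rewrite integral_cst//= lebesgue_measure_itv/= lte_fin.
case: ltP => [_|yx]; first by rewrite -EFinB -EFinM.
have -> : y = x by apply/eqP; rewrite eq_le yx xy.
by rewrite subrr mulr0 mule0.
Qed.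

(** Most bounds on the tail come from this comparison, and the upper one
    below, of the mass of a bounded interval with its length. *)
Lemma gauss_tail_diff_ge x y m : x <= y ->
  (forall t, x < t <= y -> m <= phi t) -> 0 <= m -> m * (y - x) <= T x - T y.
Proof.
move=> xy mphi m0; rewrite -lee_fin gauss_tail_diff// -integral_itv_cst//.
apply: ge0_le_integral => //.
- by apply/measurable_funTS/measurable_EFinP; exact: measurable_normal_pdf.
Qed.

Lemma gauss_tail_diff_le x y M : x <= y ->
  (forall t, x < t <= y -> phi t <= M) -> T x - T y <= M * (y - x).
Proof.
move=> xy Mphi; rewrite -lee_fin gauss_tail_diff// -integral_itv_cst//.
apply: ge0_le_integral => //.
- by move=> t _; rewrite lee_fin normal_pdf_ge0.
- by apply/measurable_funTS/measurable_EFinP; exact: measurable_normal_pdf.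
Qed.

Lemma std_normal_pdf_gt0 x : 0 < phi x.
Proof. by rewrite std_normal_pdfE mulr_gt0 ?expR_gt0// normal_peak_gt0// lt0r_neq0. Qed.

Lemma std_normal_pdf_le x y : y ^+ 2 <= x ^+ 2 -> phi x <= phi y.
Proof.
move=> xy; rewrite !std_normal_pdfE ler_pM2l; last first.
  by rewrite normal_peak_gt0// lt0r_neq0.
by rewrite ler_expR; lra.
Qed.

Lemma std_normal_pdf_le1 x : phi x <= 1.
Proof.
apply: (@le_trans _ _ (phi 0)).
  by apply: std_normal_pdf_le; rewrite expr0n sqr_ge0.
rewrite std_normal_pdfE expr0n/= oppr0 mul0r expR0 mulr1 /normal_peak.
rewrite expr1n mul1r invf_le1; last by rewrite sqrtr_gt0 mulrn_wgt0// pi_gt0.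
rewrite -[leLHS]sqrtr1; apply: ler_wsqrtr; have := pi_ge2 R; lra.
Qed.

Lemma gauss_tail_lt x y : x < y -> T y < T x.
Proof.
move=> xy; rewrite -subr_gt0.
pose m := Num.min (phi x) (phi y).
have m0 : 0 < m by rewrite lt_min !std_normal_pdf_gt0.
apply: (@lt_le_trans _ _ (m * (y - x))); first by rewrite mulr_gt0// subr_gt0.
apply: gauss_tail_diff_ge; [exact: ltW| |exact: ltW].
move=> t /andP[xt ty]; rewrite /m ge_min; apply/orP.
have [t0|t0] := leP t 0; [left|right]; apply: std_normal_pdf_le; nra.
Qed.

Lemma gauss_tail_le x y : x <= y -> T y <= T x.
Proof. by rewrite le_eqVlt => /orP[/eqP->//|/gauss_tail_lt/ltW]. Qed.

Lemma gauss_tail_leE x y : (T x <= T y) = (y <= x).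
Proof.
apply/idP/idP; last exact: gauss_tail_le.
by apply: contraTT; rewrite -!ltNge => /gauss_tail_lt.
Qed.

Lemma gauss_tail_ltE x y : (T x < T y) = (y < x).
Proof. by rewrite !ltNge gauss_tail_leE. Qed.

Lemma gauss_tail0 : T 0 = 1 / 2.
Proof. have := gauss_tailN 0; rewrite oppr0; lra. Qed.

Lemma gauss_tail_lipschitz x y : `|T x - T y| <= `|x - y|.
Proof.
wlog xy : x y / x <= y => [H|].
  have [/H//|/ltW/H] := leP x y; by rewrite distrC (distrC y).
rewrite ger0_norm ?subr_ge0 ?gauss_tail_le// distrC ger0_norm ?subr_ge0//.
rewrite -[leRHS]mul1r; apply: gauss_tail_diff_le => // t _.
exact: std_normal_pdf_le1.
Qed.

Lemma continuous_gauss_tail : continuous T.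
Proof.
move=> x; apply/cvgrPdist_le => e e0; near=> y.
apply: (le_trans (gauss_tail_lipschitz _ _)); near: y.
exact: cvgr_dist_le.
Unshelve. all: by end_near. Qed.

(** Right of [x], the standard density is at most [expR (- x ^+ 2 / 2)] times
    the density of the normal law centred at [x], which has total mass one. *)
Lemma gauss_tail_chernoff x : 0 <= x -> T x <= expR (- (x ^+ 2) / 2).
Proof.
move=> x0; rewrite -lee_fin -(normal_prob_right 0 _ ltr01) add0r mul1r.
apply: (@le_trans _ _ ((expR (- (x ^+ 2) / 2))%:E *
                       normal_prob x 1 `]x, +oo[)%E); last first.
  rewrite -[leRHS]mule1 lee_pmul2l ?lte_fin ?expR_gt0//.
  exact: probability_le1.
rewrite /normal_prob -ge0_integralZl//=; last 2 first.
- by apply/measurable_funTS/measurable_EFinP; exact: measurable_normal_pdf.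
- by move=> t _; rewrite lee_fin normal_pdf_ge0.
apply: ge0_le_integral => //=.
- by move=> t _; rewrite lee_fin normal_pdf_ge0.
- by apply/measurable_funTS/measurable_EFinP; exact: measurable_normal_pdf.
- apply/measurable_funTS/measurable_EFinP/measurable_funM => //.
  exact: measurable_normal_pdf.
- move=> t; rewrite in_itv/= andbT => xt; rewrite -EFinM lee_fin.
  rewrite std_normal_pdfE normal_pdfE ?oner_neq0// mulrCA /normal_fun -expRD.
  rewrite ler_pM2l ?normal_peak_gt0 ?oner_neq0// ler_expR expr1n.
  by rewrite -mulrDl; nra.
Qed.

Lemma gauss_tail_surj q : 0 < q <= 1 / 2 -> exists2 z, 0 <= z & T z = q.
Proof.
move=> /andP[q0 q1].
(* At [X] the exponential bound is at most [(X / 2)^-1], hence at most [q]. *)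
pose X := Num.max 1 (2 * q^-1).
have X1 : 1 <= X by rewrite le_max lexx.
have Xq : 2 * q^-1 <= X by rewrite le_max lexx orbT.
have TX : T X <= q.
  apply: (@le_trans _ _ (expR (- (X / 2)))).
    apply: (le_trans (gauss_tail_chernoff (le_trans ler01 X1))).
    by rewrite ler_expR; nra.
  rewrite expRN invf_ple ?posrE ?expR_gt0//.
  apply: le_trans (expR_ge1Dx _); lra.
have [z] : exists2 z, z \in `[0, X] & T z = q.
  apply: IVT; first exact: le_trans X1.
    exact/continuous_subspaceT/continuous_gauss_tail.
  by rewrite ge_min le_max gauss_tail0 q1 TX orbT.
by rewrite in_itv/= => /andP[z0 _] <-; exists z.
Qed.

Lemma gauss_tail_invK q : 0 < q <= 1 / 2 -> T (gauss_tail_inv q) = q.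
Proof.
move=> /gauss_tail_surj[z _ Tz]; rewrite /gauss_tail_inv.
by case: xgetP => // /(_ z).
Qed.

Lemma gauss_tail_ge0 x : 0 <= T x.
Proof. by rewrite /gauss_tail fine_ge0. Qed.

Lemma std_normal_pdf_shift x y :
  phi y = phi x * expR ((x ^+ 2 - y ^+ 2) / 2).
Proof. by rewrite !std_normal_pdfE -mulrA -expRD; congr (_ * expR _); field. Qed.

(** The tail at [z] contains an interval of length [(1 + z)^-1], along which
    the density drops by a factor at most [expR (3 / 2)]. *)
Lemma gauss_tail_mills z : 0 <= z -> phi z <= expR (3 / 2) * (1 + z) * T z.
Proof.
move=> z0; pose v := (1 + z)^-1.
have v0 : 0 < v by rewrite invr_gt0; lra.
have vz : v * (1 + z) = 1 by rewrite mulVf//; lra.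
have v1 : v <= 1 by nra.
have : phi (z + v) * (z + v - z) <= T z - T (z + v).
  apply: gauss_tail_diff_ge; [lra| |exact/ltW/std_normal_pdf_gt0].
  by move=> t /andP[zt tv]; apply: std_normal_pdf_le; nra.
rewrite addrAC subrr add0r => H.
have {}H : phi (z + v) * v <= T z by have := gauss_tail_ge0 (z + v); lra.
have P : phi z * expR (- (3 / 2)) <= phi (z + v).
  rewrite (std_normal_pdf_shift z (z + v)) ler_pM2l ?std_normal_pdf_gt0//.
  by rewrite ler_expR; nra.
have E0 := expR_gt0 (3 / 2 : R).
have Q : phi (z + v) <= (1 + z) * T z.
  have -> : phi (z + v) = (1 + z) * (phi (z + v) * v).
    by rewrite mulrCA [_ * v]mulrC vz mulr1.
  by apply: ler_wpM2l => //; lra.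
rewrite -mulrA -ler_pdivrMl// -expRN mulrC; exact: le_trans P Q.
Qed.

(** A shift by [h] costs at most [h] times the largest density on the way,
    which is [phi z] up to a factor [expR (z * h)]; the Mills bound converts
    [phi z] back into the tail. So a shift by [h] is a relative error of order
    [h * (1 + z)]. The exponent 5/2 is 3/2 from the Mills bound plus 1 from
    the shift. *)
Lemma gauss_tail_ratio_left z h b : 0 <= z -> 0 <= h -> h * (1 + z) <= b ->
  b <= 1 -> T (z - h) <= (1 + expR (5 / 2) * b) * T z.
Proof.
move=> z0 h0 hb b1.
have zhb : z * h <= 1 by nra.
have : T (z - h) - T z <= (phi z * expR 1) * (z - (z - h)).
  apply: gauss_tail_diff_le; first lra.
  move=> t /andP[zt tz]; rewrite (std_normal_pdf_shift z t).
  by rewrite ler_pM2l ?std_normal_pdf_gt0// ler_expR; nra.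
have M := gauss_tail_mills z0.
have -> : (5 / 2 : R) = 3 / 2 + 1 by lra.
rewrite expRD; have e0 := expR_gt0 (1 : R); have E0 := expR_gt0 (3 / 2 : R).
have T0 := gauss_tail_ge0 z; move: M; set p := phi z; set e := expR 1.
set E := expR _; set t := T z => M H.
have : p * e * (z - (z - h)) <= E * e * b * t.
  apply: (@le_trans _ _ (E * (1 + z) * t * e * h)).
    have -> : z - (z - h) = h by ring.
    by apply: ler_wpM2r => //; apply: ler_wpM2r => //; exact: ltW.
  have -> : E * (1 + z) * t * e * h = (E * e * t) * (h * (1 + z)) by ring.
  have -> : E * e * b * t = (E * e * t) * b by ring.
  by apply: ler_wpM2l => //; rewrite !mulr_ge0// ltW.
lra.
Qed.

Lemma gauss_tail_ratio_right z h b : 0 <= z -> 0 <= h -> h * (1 + z) <= b ->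
  (1 - expR (3 / 2) * b) * T z <= T (z + h).
Proof.
move=> z0 h0 hb.
have : T z - T (z + h) <= phi z * (z + h - z).
  apply: gauss_tail_diff_le; first lra.
  by move=> t /andP[zt tz]; apply: std_normal_pdf_le; nra.
have M := gauss_tail_mills z0.
have T0 := gauss_tail_ge0 z; have E0 := expR_gt0 (3 / 2 : R).
move: M; set p := phi z; set E := expR _; set t := T z => M H.
have : p * (z + h - z) <= E * b * t.
  apply: (@le_trans _ _ (E * (1 + z) * t * h)).
    have -> : z + h - z = h by ring.
    exact: ler_wpM2r.
  have -> : E * (1 + z) * t * h = (E * t) * (h * (1 + z)) by ring.
  have -> : E * b * t = (E * t) * b by ring.
  by apply: ler_wpM2l => //; rewrite !mulr_ge0// ltW.
lra.
Qed.

Definition quartile : R := gauss_tail_inv (1 / 4).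

Lemma gauss_tail_quartile : T quartile = 1 / 4.
Proof. by apply: gauss_tail_invK; lra. Qed.

Lemma quartile_bounds : 1 / 4 <= quartile <= 3.
Proof.
have q := gauss_tail_quartile.
have q0 : 0 <= quartile by rewrite -gauss_tail_leE q gauss_tail0; lra.
apply/andP; split.
  have : T 0 - T quartile <= 1 * (quartile - 0).
    by apply: gauss_tail_diff_le => // t _; exact: std_normal_pdf_le1.
  by rewrite q gauss_tail0; lra.
rewrite -gauss_tail_leE q; apply: le_trans (gauss_tail_chernoff _) _; first lra.
rewrite mulNr expRN.
apply: (@le_trans _ _ ((1 + 3 ^+ 2 / 2 : R)^-1)).
  by rewrite lef_pV2 ?posrE ?expR_gt0 ?expR_ge1Dx//; lra.
by rewrite invf_ple ?posrE; lra.
Qed.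

(** The smallest value of the density on [- 4, 4]. The upper quartile is at
    most 3, so this interval contains all points where the masses of the four
    events below are compared with 1/2. *)
Definition slope : R := phi 4.

Lemma gauss_tail_slope x y : - 4 <= x -> x <= y -> y <= 4 ->
  slope * (y - x) <= T x - T y.
Proof.
move=> x4 xy y4; apply: gauss_tail_diff_ge => //.
  by move=> t /andP[xt ty]; apply: std_normal_pdf_le; nra.
exact/ltW/std_normal_pdf_gt0.
Qed.

(** The four events that locate the median and the median absolute deviation.
    Each has null probability above one half, by a margin linear in [d]. *)
Lemma normal_mass_below (th s d : R) : 0 < s -> 0 <= d -> d < 1 / 4 ->
 
  ((1 / 2 + slope * d)%:E <= normal_prob th s [set y | (y < th + s * d)%R])%E.
Proof.
move=> s0 d0 d1.
rewrite -set_itvNyo -[th + s * d]opprK.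
have -> : - - (th + s * d) = th - s * (- d) by ring.
rewrite normal_prob_left// lee_fin.
have : slope * (0 - - d) <= T (- d) - T 0.
  apply: gauss_tail_slope; lra.
rewrite gauss_tail0; lra.
Qed.

Lemma normal_mass_above (th s d : R) : 0 < s -> 0 <= d -> d < 1 / 4 ->
 
  ((1 / 2 + slope * d)%:E <= normal_prob th s [set y | (th - s * d < y)%R])%E.
Proof.
move=> s0 d0 d1.
rewrite -set_itvoy -mulrN normal_prob_right// lee_fin.
have : slope * (0 - - d) <= T (- d) - T 0.
  apply: gauss_tail_slope; lra.
rewrite gauss_tail0; lra.
Qed.

Lemma normal_prob_two_tails th s x y : 0 < s -> 0 < x + y ->
  normal_prob th s (`]-oo, (th - s * x)[ `|` `]th + s * y, +oo[) =
  (T x + T y)%:E.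
Proof.
move=> s0 xy; rewrite measureU//; last first.
  apply/seteqP; split => t //= -[]; rewrite !in_itv/= andbT => t1 t2; nra.
by rewrite /= normal_prob_left// normal_prob_right.
Qed.

Lemma normal_mass_centre (th s d : R) : 0 < s -> 0 <= d -> d < 1 / 4 ->
  ((1 / 2 + slope * d)%:E <=
  normal_prob th s [set y | (`|y - th| <= s * (quartile + d))%R])%E.
Proof.
move=> s0 d0 d1.
set q := quartile + d; have := quartile_bounds => /andP[q1 q2].
have -> : [set y | (`|y - th| <= s * q)%R] =
    ~` (`]-oo, th - s * q[ `|` `]th + s * q, +oo[).
  apply/seteqP; split => y /=; rewrite !in_itv/= andbT ler_norml.
    by move=> /andP[a b] [c|c]; lra.
  move=> /not_orP[/negP a /negP b]; rewrite -!leNgt in a b.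
  by apply/andP; split; lra.
rewrite probability_setC; last exact: measurableU.
rewrite /= normal_prob_two_tails//; last by rewrite /q; lra.
rewrite -EFinB lee_fin.
have : slope * (q - quartile) <= T quartile - T q.
  by apply: gauss_tail_slope; rewrite /q; lra.
rewrite gauss_tail_quartile /q.
have := mulr_ge0 (ltW (std_normal_pdf_gt0 4)) d0; rewrite -/slope; lra.
Qed.

Lemma normal_mass_off_centre (th s d : R) : 0 < s -> 0 <= d -> d < 1 / 4 ->
  ((1 / 2 + slope * d)%:E <=
  normal_prob th s [set y | (s * (quartile - d) < `|y - th|)%R])%E.
Proof.
move=> s0 d0 d1.
set q := quartile - d; have := quartile_bounds => /andP[q1 q2].
have -> : [set y | (s * q < `|y - th|)%R] =
    (`]-oo, th - s * q[ `|` `]th + s * q, +oo[).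
  apply/seteqP; split => y /=; rewrite !in_itv/= andbT ltr_normr.
    by move=> /orP[|] ?; [right|left]; lra.
  by move=> [|] ?; apply/orP; [right|left]; lra.
rewrite /= normal_prob_two_tails//; last by rewrite /q; lra.
rewrite lee_fin.
have : slope * (quartile - q) <= T q - T quartile.
  by apply: gauss_tail_slope; rewrite /q; lra.
rewrite gauss_tail_quartile /q.
have := mulr_ge0 (ltW (std_normal_pdf_gt0 4)) d0; rewrite -/slope; lra.
Qed.
End gaussian.

(** * Leave-one-out stability of the plug-in procedure *)

Lemma ord_size_gt0 (R : numDomainType) n (i : 'I_n) : (0 : R) < n%:R.
Proof. by rewrite ltr0n (leq_trans _ (ltn_ord i)). Qed.

Lemma nonempty_card_range n (S : {set 'I_n}) i : i \in S -> (0 < #|S| <= n)%N.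
Proof.
move=> iS; apply/andP; split; first by apply/card_gt0P; exists i.
by rewrite -[leqRHS]card_ord max_card.
Qed.

Section bh.
Context {R : realType} {n : nat}.
Implicit Types (p : 'I_n -> R) (y : n.-tuple R) (S : {set 'I_n}).

(** This lemma and the next one characterise the rejection set as the largest
    set [S] whose p-values are all at most [alpha * #|S| / n]. *)
Lemma bh_self_consistent alpha p i : 0 < alpha ->
  i \in bh_rejection alpha p ->
  p i <= alpha * #|bh_rejection alpha p|%:R / n%:R.
Proof.
move=> a0; rewrite in_bh_rejection// => /existsP[m /andP[pim mc]].
have n0 := ord_size_gt0 R i.
apply: (le_trans pim); rewrite ge_min; apply/orP; right.
rewrite ler_pM2r ?invr_gt0// ler_pM2l// ler_nat.
apply: (leq_trans mc); apply/subset_leq_card/fintype.subsetP => j.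
rewrite inE => pj; rewrite in_bh_rejection//; apply/existsP; exists m.
exact/andP.
Qed.

Lemma bh_maximal alpha p S : 0 < alpha < 1 ->
  (forall i, i \in S -> p i <= alpha * #|S|%:R / n%:R) ->
  S \subset bh_rejection alpha p.
Proof.
move=> /andP[a0 a1] pS; apply/fintype.subsetP => i iS.
have n0 := ord_size_gt0 R i.
have Sn : (#|S| < n.+1)%N by rewrite ltnS -[X in (_ <= X)%N]card_ord max_card.
have stepE : Num.min 1 (alpha * #|S|%:R / n%:R) = alpha * #|S|%:R / n%:R.
  apply/min_r; rewrite ler_pdivrMr// mul1r.
  apply: (@le_trans _ _ #|S|%:R); last by rewrite ler_nat -ltnS.
  by rewrite ler_piMl// ltW.
rewrite in_bh_rejection//; apply/existsP; exists (Ordinal Sn) => /=.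
rewrite stepE pS//=; apply/subset_leq_card/fintype.subsetP => j jS.
by rewrite inE pS.
Qed.

Lemma bh_rejection_le alpha p i : 0 < alpha ->
  i \in bh_rejection alpha p -> p i <= alpha.
Proof.
move=> a0 iR; apply: (le_trans (bh_self_consistent a0 iR)).
have n0 := ord_size_gt0 R i.
rewrite ler_pdivrMr// ler_pM2l// ler_nat.
by rewrite -[X in (_ <= X)%N]card_ord max_card.
Qed.

(** The union of the two rejection sets is self-consistent for each of the two
    families of p-values: at the common coordinate [i] because [i] is rejected
    in both, elsewhere because the p-values agree. Maximality makes both sets
    equal to the union. *)
Lemma bh_rejection_local alpha p p' i : 0 < alpha < 1 ->
  (forall j, j != i -> p j = p' j) ->
  i \in bh_rejection alpha p -> i \in bh_rejection alpha p' ->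
  bh_rejection alpha p = bh_rejection alpha p'.
Proof.
move=> /andP[a0 a1].
suff main q q' : (forall j, j != i -> q j = q' j) ->
    i \in bh_rejection alpha q' -> bh_rejection alpha q \subset
    bh_rejection alpha q'.
  move=> pp' ip ip'; apply/eqP; rewrite finset.eqEsubset main//=.
  by apply: main => // j /pp'.
move=> qq' iq'.
set S := bh_rejection alpha q; set S' := bh_rejection alpha q' in iq' *.
have n0 := ord_size_gt0 R i.
apply: fintype.subset_trans (finset.subsetUl S S') _.
apply: bh_maximal => [|j]; first by rewrite a0.
have mono (A B : {set 'I_n}) : A \subset B ->
    alpha * #|A|%:R / n%:R <= alpha * #|B|%:R / n%:R.
  by move=> /subset_leq_card AB; rewrite ler_pM2r ?invr_gt0// ler_pM2l// ler_nat.
rewrite finset.inE => /orP[jS|jS'].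
  have [->|ji] := eqVneq j i.
    exact: le_trans (bh_self_consistent a0 iq') (mono _ _ (finset.subsetUr _ _)).
  rewrite -qq'//.
  exact: le_trans (bh_self_consistent a0 jS) (mono _ _ (finset.subsetUl _ _)).
exact: le_trans (bh_self_consistent a0 jS') (mono _ _ (finset.subsetUr _ _)).
Qed.

Lemma order_stat_leE (v : n.-tuple R) m t : (0 < m <= n)%N ->
  (order_stat v m <= t) = (m <= #|[set j | (tnth v j <= t)%R]%SET|)%N.
Proof.
move=> mn; rewrite order_stat_le ?size_tuple//.
by rewrite -sum1_count -sum1dep_card big_tuple.
Qed.

(** The coordinates counted by [order_stat v' m] all differ from [i], so [v]
    has them too. *)
Lemma order_stat_above (v v' : n.-tuple R) m i : (0 < m <= n)%N ->
  (forall j, j != i -> tnth v j = tnth v' j) ->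
  order_stat v' m < tnth v' i -> order_stat v m <= order_stat v' m.
Proof.
move=> mn vv' vi; rewrite order_stat_leE//.
have := lexx (order_stat v' m); rewrite {1}order_stat_leE// => /leq_trans; apply.
apply/subset_leq_card/fintype.subsetP => j; rewrite !finset.inE.
have [->|ji] := eqVneq j i; first by rewrite leNgt vi.
by rewrite vv'.
Qed.

(** Otherwise the larger of [v_i] and [order_stat v' m] would lie below
    [order_stat v m], although at least [m] values of [v] are at most this
    maximum, [v_i] being one of them. *)
Lemma order_stat_below (v v' : n.-tuple R) m i : (0 < m <= n)%N ->
  (forall j, j != i -> tnth v j = tnth v' j) ->
  tnth v i < order_stat v m -> order_stat v m <= order_stat v' m.
Proof.
move=> mn vv' vi.
suff : order_stat v m <= Num.max (tnth v i) (order_stat v' m).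
  by rewrite le_max leNgt vi.
rewrite order_stat_leE//.
have := lexx (order_stat v' m); rewrite {1}order_stat_leE// => /leq_trans; apply.
apply/subset_leq_card/fintype.subsetP => j; rewrite !finset.inE le_max.
have [->|ji] := eqVneq j i; first by rewrite lexx.
by rewrite vv'// => ->; rewrite orbT.
Qed.

Lemma order_stat_local (v v' : n.-tuple R) m i : (0 < m <= n)%N ->
  (forall j, j != i -> tnth v j = tnth v' j) ->
  (order_stat v m < tnth v i /\ order_stat v' m < tnth v' i) \/
  (tnth v i < order_stat v m /\ tnth v' i < order_stat v' m) ->
  order_stat v m = order_stat v' m.
Proof.
move=> mn vv'; have v'v j : j != i -> tnth v' j = tnth v j by move/vv'.
move=> [[a b]|[a b]]; apply/eqP; rewrite eq_le.
  by rewrite (order_stat_above mn vv')// (order_stat_above mn v'v).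
by rewrite (order_stat_below mn vv')// (order_stat_below mn v'v).
Qed.

Definition abs_dev y : n.-tuple R := [tuple `|tnth y i - theta_tilde y| | i < n].

Lemma uphalf_range (i : 'I_n) : (0 < uphalf n <= n)%N.
Proof. by case: (n) i => [[]//|k] _; rewrite uphalf_half; lia. Qed.

(** Here the bound [alpha < 1 / 2] matters: a rejected p-value is below 1/2,
    so the deviation exceeds [quartile * sigma_tilde], which is the median of
    the absolute deviations. *)
Lemma abs_dev_gt alpha y i : 0 < alpha < 1 / 2 -> 0 < sigma_tilde y ->
  i \in BH alpha y (theta_tilde y) (sigma_tilde y) ->
  order_stat (abs_dev y) (uphalf n) < `|tnth y i - theta_tilde y|.
Proof.
move=> /andP[a0 a12] s0 /(bh_rejection_le a0); rewrite /pvalue => pa.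
have q0 : 0 < @quartile R by have /andP[] := @quartile_bounds R; lra.
have : gauss_tail (`|tnth y i - theta_tilde y| / sigma_tilde y) <
    gauss_tail quartile by rewrite gauss_tail_quartile; lra.
rewrite gauss_tail_ltE ltr_pdivlMr// {1}/sigma_tilde -/(quartile) mulrC.
by rewrite divfK// gt_eqF.
Qed.

(** A rejected coordinate lies strictly on one side of the median and strictly
    above the median deviation. Moving it on its side, as long as it stays
    rejected, changes neither median, and hence no other p-value. *)
Lemma BH_leave_one_out alpha y y' i : 0 < alpha < 1 / 2 ->
  (forall j, j != i -> tnth y j = tnth y' j) ->
  0 < sigma_tilde y -> 0 < sigma_tilde y' ->
  i \in BH alpha y (theta_tilde y) (sigma_tilde y) ->
  i \in BH alpha y' (theta_tilde y') (sigma_tilde y') ->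
  (theta_tilde y < tnth y i /\ theta_tilde y' < tnth y' i) \/
  (tnth y i < theta_tilde y /\ tnth y' i < theta_tilde y') ->
  [/\ theta_tilde y = theta_tilde y', sigma_tilde y = sigma_tilde y' &
   BH alpha y (theta_tilde y) (sigma_tilde y) =
   BH alpha y' (theta_tilde y') (sigma_tilde y')].
Proof.
move=> a yy' s0 s0' iR iR' side; have mn := uphalf_range i.
have tE : theta_tilde y = theta_tilde y' by exact: (order_stat_local mn yy' side).
have sE : sigma_tilde y = sigma_tilde y'.
  rewrite /sigma_tilde; congr (_ / _).
  apply: (@order_stat_local (abs_dev y) (abs_dev y') _ i mn).
    by move=> j ji; rewrite !tnth_mktuple yy'// tE.
  left; rewrite !tnth_mktuple.
  exact: (conj (abs_dev_gt a s0 iR) (abs_dev_gt a s0' iR')).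
split; [exact: tE|exact: sE|].
have a01 : 0 < alpha < 1 by move/andP: a => [-> a12] /=; lra.
apply: (bh_rejection_local a01 _ iR iR') => j ji.
by rewrite /pvalue yy'// tE sE.
Qed.

End bh.

(** * Gaussian tails under perturbed location and scale *)

Section perturbation.
Context {R : realType}.
Implicit Types (th s u v d z b tau t : R).
Local Notation T := (@gauss_tail R).

(** The only levels that matter are at least [alpha / n]: quantiles at such
    levels are at most of order the square root of the logarithm, so the
    relative errors [d * (1 + z) ^+ 2] of the tail ratios are at most of order
    [d * ln (n / alpha)]. *)
Lemma quantile_sqr_bound (N alpha : R) z : 0 < alpha -> 2 * alpha <= N ->
  1 <= ln (N / alpha) -> 0 <= z -> alpha / (2 * N) <= T z ->
  (1 + z) ^+ 2 <= 10 * ln (N / alpha).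
Proof.
move=> a0 Na L1 z0 Tz; set L := ln _ in L1 *.
have N0 : 0 < N by lra.
have NaP : 0 < N / alpha by rewrite divr_gt0.
have L2 : ln (2 : R) <= L.
  by rewrite ler_ln ?posrE// ler_pdivlMr.
suff zL : z ^+ 2 / 2 <= 2 * L.
  by have := sqr_ge0 (z - 1); nra.
have : alpha / (2 * N) <= expR (- (z ^+ 2) / 2).
  exact: le_trans Tz (gauss_tail_chernoff z0).
have -> : alpha / (2 * N) = expR (- (ln 2 + L)).
  rewrite expRN expRD !lnK ?posrE//; field.
  by rewrite !gt_eqF.
rewrite ler_expR; lra.
Qed.

(** With parameters off by a relative error [d], the plug-in rejection region
    with true quantile [z] is contained in the oracle region at a quantile
    smaller by [d * (1 + z)]. *)
Lemma plugin_tail_right th s u v d z t : 0 < s -> 0 < v -> 0 <= z ->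
  `|u - th| <= s * d -> `|v - s| <= s * d ->
  u < t -> T (`|t - u| / v) <= T z -> th + s * (z - d * (1 + z)) <= t.
Proof.
move=> s0 v0 z0 /ler_normlP[u1 u2] /ler_normlP[v1 v2] ut.
rewrite gauss_tail_leE ler_pdivlMr// gtr0_norm ?subr_gt0// => zv.
nra.
Qed.

Lemma plugin_tail_left th s u v d z t : 0 < s -> 0 < v -> 0 <= z ->
  `|u - th| <= s * d -> `|v - s| <= s * d ->
  t < u -> T (`|t - u| / v) <= T z -> t <= th - s * (z - d * (1 + z)).
Proof.
move=> s0 v0 z0 /ler_normlP[u1 u2] /ler_normlP[v1 v2] ut.
rewrite gauss_tail_leE ler_pdivlMr// distrC gtr0_norm ?subr_gt0// => zv.
nra.
Qed.

(** The converse comparison: the factor [1 - eta] on the oracle level pays for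
    the shift of the quantile by [d * (1 + z)]. *)
Lemma plugin_tail_oracle th s u v d z b eta t : 0 < s -> 0 < v -> 0 <= z ->
  0 <= d -> d * (1 + z) ^+ 2 <= b -> expR (3 / 2) * b < eta ->
  `|u - th| <= s * d -> `|v - s| <= s * d -> 0 < T z ->
  T (`|t - th| / s) <= (1 - eta) * T z -> T (`|t - u| / v) <= T z.
Proof.
move=> s0 v0 z0 d0 db beta uth vs Tz Tt.
have H : T (`|t - th| / s) < T (z + d * (1 + z)).
  have h0 : 0 <= d * (1 + z) by rewrite mulr_ge0//; lra.
  have hb : d * (1 + z) * (1 + z) <= b by rewrite -mulrA -expr2.
  apply: (le_lt_trans Tt); apply: lt_le_trans (gauss_tail_ratio_right z0 h0 hb).
  by rewrite ltr_pM2r//; lra.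
rewrite gauss_tail_ltE ltr_pdivlMr// in H.
rewrite gauss_tail_leE ler_pdivlMr//.
move/ler_normlP: vs => [v1 v2].
have tri : `|t - th| <= `|t - u| + `|u - th|.
  by rewrite (le_trans _ (ler_normD _ _))// subrKA.
nra.
Qed.
End perturbation.

(** * Samples on which the estimators are accurate *)

Section good_event.
Context {R : realType} {n : nat}.
Implicit Types (y : n.-tuple R) (B : pred R).

(** Medians are controlled by counting: only the events that hold for more
    than half of the coordinates matter, whatever the other coordinates do. *)
Definition majority B y : bool := (n./2 < #|[set i | B (tnth y i)]%SET|)%N.

Definition good_sample (th s d : R) y : bool :=
  [&& majority (fun x => x < th + s * d) y,
      majority (fun x => th - s * d < x) y,
      majority (fun x => `|x - th| <= s * (quartile + d)) y &
      majority (fun x => s * (quartile - d) < `|x - th|) y].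

Lemma majority_order_stat_le B y (v : n.-tuple R) t :
  majority B y -> (forall i, B (tnth y i) -> tnth v i <= t) ->
  order_stat v (uphalf n) <= t.
Proof.
move=> M Bt; have [i _] : exists i, i \in [set i | B (tnth y i)]%SET.
  by apply/card_gt0P; exact: leq_trans M.
rewrite order_stat_leE ?(uphalf_range i)//.
apply: (@leq_trans #|[set i | B (tnth y i)]%SET|).
  by move: M; rewrite /majority uphalf_half; case: odd => /=; lia.
by apply/subset_leq_card/fintype.subsetP => j; rewrite !finset.inE => /Bt.
Qed.

(** Otherwise [uphalf n] coordinates have [v_i <= t], and together with the
    majority they would be more than [n]. *)
Lemma majority_order_stat_ge B y (v : n.-tuple R) t :
  majority B y -> (forall i, B (tnth y i) -> t < tnth v i) ->
  t < order_stat v (uphalf n).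
Proof.
move=> M Bt; have [i _] : exists i, i \in [set i | B (tnth y i)]%SET.
  by apply/card_gt0P; exact: leq_trans M.
rewrite ltNge order_stat_leE ?(uphalf_range i)//; apply/negP => C.
have : (#|[set i | B (tnth y i)]%SET| +
        #|[set j | (tnth v j <= t)%R]%SET| <= n)%N.
  rewrite -cardsUI (_ : _ :&: _ = finset.set0) ?cards0 ?addn0.
    by rewrite -[leqRHS]card_ord max_card.
  apply/setP => j; rewrite !finset.inE; apply/negbTE/negP => /andP[/Bt].
  by rewrite ltNge => /negbTE ->.
have : (n./2 + uphalf n = n)%N by rewrite uphalf_half; lia.
by move: M C; rewrite /majority; lia.
Qed.

(** The first two majorities place the median within [s * d] of [th]. The
    deviations from it then differ by at most [s * d] from those from [th],
    and the last two majorities place their median within [2 * s * d] of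
    [s * quartile]. The factor 8 is twice the inverse of the lower bound 1/4
    on the quartile. *)
Lemma good_sample_estimators th s d y : 0 < s -> 0 <= d < 1 / 8 ->
  good_sample th s d y ->
  [/\ `|theta_tilde y - th| <= s * (8 * d),
      `|sigma_tilde y - s| <= s * (8 * d) & 0 < sigma_tilde y].
Proof.
move=> s0 /andP[d0 d8] /and4P[M1 M2 M3 M4].
have u1 : theta_tilde y <= th + s * d.
  by apply: (majority_order_stat_le M1) => i /ltW.
have u2 : th - s * d < theta_tilde y by exact: (majority_order_stat_ge M2).
have uth : `|theta_tilde y - th| <= s * d.
  by rewrite ler_norml; apply/andP; split; lra.
have := @quartile_bounds R => /andP[q1 q2].
set U := order_stat (abs_dev y) (uphalf n).
have U1 : U <= s * (quartile + 2 * d).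
  apply: (majority_order_stat_le M3) => i yi; rewrite tnth_mktuple.
  have : `|tnth y i - theta_tilde y| <= `|tnth y i - th| + `|theta_tilde y - th|.
    by rewrite (distrC (theta_tilde y)) (le_trans _ (ler_normD _ _))// subrKA.
  by move=> /le_trans; apply; lra.
have U2 : s * (quartile - 2 * d) < U.
  apply: (majority_order_stat_ge M4) => i yi; rewrite tnth_mktuple.
  have : `|tnth y i - th| <= `|tnth y i - theta_tilde y| + `|theta_tilde y - th|.
    by rewrite (le_trans _ (ler_normD _ _))// subrKA.
  by lra.
have sE : sigma_tilde y = U / quartile by [].
have q0 : 0 < @quartile R by lra.
have Sq : sigma_tilde y * quartile = U by rewrite sE divfK// gt_eqF.
have sd : 0 <= s * d by rewrite mulr_ge0// ltW.
have sv : `|sigma_tilde y - s| <= s * (8 * d).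
  by rewrite ler_norml; apply/andP; split; nra.
split=> //; first by lra.
by move: sv => /ler_normlP[]; nra.
Qed.

End good_event.

(** * Resampling one coordinate of a product law *)

Section resampling.
Context {R : realType} {n : nat}.
Implicit Types (y : n.-tuple R) (B : 'I_n -> set R) (i j : 'I_n).

Definition update i y (t : R) : n.-tuple R :=
  [tuple if j == i then t else tnth y j | j < n].

Lemma measurable_update i :
  measurable_fun setT
    (fun z : n.-tuple R * measurableTypeR R => update i z.1 z.2).
Proof.
apply/measurable_fun_tnthP => j.
have [ji|ji] := eqVneq j i.
  rewrite (_ : _ \o _ = snd)//; apply/funext => z /=.
  by rewrite tnth_mktuple ji eqxx.
rewrite (_ : _ \o _ = (fun x => tnth x j) \o fst).
  by apply: measurableT_comp => //; exact: measurable_tnth.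
by apply/funext => z /=; rewrite tnth_mktuple (negbTE ji).
Qed.

Lemma measurable_update_coord i y :
  measurable_fun setT (fun t : measurableTypeR R => update i y t).
Proof.
apply/measurable_fun_tnthP => j; have [ji|ji] := eqVneq j i.
  rewrite (_ : _ \o _ = id); first exact: measurable_id.
  by apply/funext => t /=; rewrite tnth_mktuple ji eqxx.
rewrite (_ : _ \o _ = cst (tnth y j)); first exact: measurable_cst.
by apply/funext => t /=; rewrite tnth_mktuple (negbTE ji).
Qed.

Definition box B : set (n.-tuple R) := [set y | forall i, B i (tnth y i)].

Lemma measurable_box B : (forall i, measurable (B i)) -> measurable (box B).
Proof.
move=> mB; rewrite (_ : box B = \bigcap_(i in [set: 'I_n])
    ((fun y : n.-tuple R => tnth y i) @^-1` B i)).
  apply: fin_bigcap_measurable => // i _; rewrite -[X in measurable X]setTI.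
  exact: measurable_tnth.
by apply/seteqP; split=> [y yB i _|y yB i]; [exact: yB|exact: (yB i)].
Qed.

Definition boxes : set (set (n.-tuple R)) :=
  [set box B | B in [set B | forall i, measurable (B i)]].

(** Boxes form a pi-system generating the sigma-algebra, so a product law is
    determined by its marginals. *)
Lemma measurable_tupleE : (@measurable _ (n.-tuple R)) = <<s boxes >>.
Proof.
apply/seteqP; split.
  apply: smallest_sub; first exact: smallest_sigma_algebra.
  rewrite -bigcup_seq => A [i _ [C mC <-]]; apply: sub_sigma_algebra.
  exists (fun j => if j == i then C else setT) => [j|]; first by case: ifP.
  rewrite setTI; apply/seteqP; split=> [y /(_ i)|y yC j] /=; first by rewrite eqxx.
  by case: eqP => // ->.
apply: smallest_sub; first exact: sigma_algebra_measurable.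
by move=> _ [B mB <-]; exact: measurable_box.
Qed.

Lemma setI_closed_boxes : setI_closed boxes.
Proof.
move=> _ _ [B mB <-] [C mC <-]; exists (fun i => B i `&` C i).
  by move=> i; exact: measurableI.
apply/seteqP; split=> [y yBC|y [yB yC] i]; last by split.
by split=> i; have [] := yBC i.
Qed.

Variables (P : probability (n.-tuple R) R) (Q : probability (measurableTypeR R) R).
Variable i : 'I_n.
Hypothesis Pprod : product_law P.
Hypothesis Pi : forall C : set R, measurable C -> marginal P i C = Q C.

Lemma resample_box B : (forall j, measurable (B j)) ->
  (P \x Q)%E ((fun z => update i z.1 z.2) @^-1` box B) = P (box B).
Proof.
move=> mB; pose B' j := if j == i then setT else B j.
have mB' j : measurable (B' j) by rewrite /B'; case: ifP.
have -> : (fun z => update i z.1 z.2) @^-1` box B = box B' `*` B i.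
  apply/seteqP; split=> [[y t] H|[y t] [/= H Ht] j /=].
    split=> [j|] /=; last by have := H i; rewrite tnth_mktuple eqxx.
    by have := H j; rewrite /B' tnth_mktuple; case: eqP.
  by have := H j; rewrite /B' tnth_mktuple; case: eqP => // ->.
rewrite product_measure1E; [|exact: (measurable_box mB')|exact: (mB i)].
transitivity ((\prod_(j < n) marginal P j (B' j)) * Q (B i))%E.
  by congr (_ * _)%E; exact: Pprod.
have -> : P (box B) = (\prod_(j < n) marginal P j (B j))%E by exact: Pprod.
rewrite (bigD1 i erefl)/= [in RHS](bigD1 i erefl)/= {1}/B' eqxx !Pi//.
rewrite probability_setT mul1e muleC; congr (_ * _)%E.
by apply: eq_bigr => j /negbTE ji; rewrite /B' ji.
Qed.

Lemma resample_measure A : measurable A ->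
  P A = pushforward (P \x Q)%E (fun z => update i z.1 z.2) A.
Proof.
move=> mA.
apply: (measure_unique boxes (fun=> setT) measurable_tupleE setI_closed_boxes)=> //.
- by move=> _; exists (fun=> setT) => //; apply/seteqP; split.
- by rewrite bigcup_const.
- exact: measurable_update.
- by move=> mf _ [B mB <-]; exact/esym/resample_box.
- by move=> _; rewrite -ge0_fin_numE ?measure_ge0// fin_num_measure.
Qed.

(** A coordinate of a product law may be integrated separately, with the other
    coordinates kept: all uses of independence go through this identity. *)
Lemma resample_integral (f : n.-tuple R -> \bar R) :
  measurable_fun setT f -> (forall y, 0 <= f y)%E ->
  (\int[P]_y f y = \int[P]_y \int[Q]_t f (update i y t))%E.
Proof.
move=> mf f0; transitivity (\int[pushforward (P \x Q)%E
    (fun z => update i z.1 z.2)]_y f y)%E.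
  apply: eq_measure_integral; first exact: measurable_update.
  by move=> ? A mA _; exact: resample_measure.
rewrite ge0_integral_pushforward//; last exact: measurable_update.
rewrite preimage_setT fubini_tonelli1//; last by move=> z; exact: f0.
by apply: measurableT_comp => //; exact: measurable_update.
Qed.

Lemma measurable_resample (f : n.-tuple R -> \bar R) :
  measurable_fun setT f -> (forall y, 0 <= f y)%E ->
  measurable_fun setT (fun y => (\int[Q]_t f (update i y t))%E).
Proof.
move=> mf f0.
have := @measurable_fun_fubini_tonelli_F _ _ (n.-tuple R) (measurableTypeR R) R Q
  (fun z => f (update i z.1 z.2)).
apply.
  by apply: measurableT_comp => //; exact: measurable_update.
by move=> z; exact: f0.
Qed.

End resampling.

(** * A Chernoff bound for majorities *)

Lemma prob_integral_cst d (T : measurableType d) (R : realType)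
  (P : probability T R) (r : \bar R) : (\int[P]_x r = r)%E.
Proof.
have := @integral_cst _ T R P setT measurableT r.
by move=> /= ->; rewrite probability_setT mule1.
Qed.

Lemma prob_integral_indic d (T : measurableType d) (R : realType)
  (P : probability T R) (A : set T) : measurable A ->
  (\int[P]_x (\1_A x)%:E = P A)%E.
Proof. by move=> mA; rewrite integral_indic// setIT. Qed.

Lemma measurable_negb d (T : measurableType d) (b : pred T) :
  measurable [set y | b y] -> measurable [set y | ~~ b y].
Proof.
move=> mb; rewrite (_ : [set y | ~~ b y] = ~` [set y | b y]).
  exact: measurableC.
by apply/seteqP; split=> y /= /negP.
Qed.

Section measurability.
Context {R : realType} {n : nat}.

Lemma measurable_mtp_comp (rej : mtp R n) (h : {set 'I_n} -> R) :
  measurable_fun setT (fun y => h (rej y)).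
Proof.
move=> _ Y mY; rewrite setTI (_ : _ @^-1` Y =
    \bigcup_(S in [set S | Y (h S)]) rej @^-1` [set S]).
  by apply: fin_bigcup_measurable => // S _; exact: mtp_measurable.
by apply/seteqP; split=> [y Yy|y [S YS /= ->]//]; exists (rej y).
Qed.

Lemma measurable_mtp_rel (rej rej' : mtp R n)
    (Z : {set 'I_n} -> {set 'I_n} -> bool) :
  measurable [set y | Z (rej y) (rej' y)].
Proof.
rewrite (_ : [set y | _] = \bigcup_(S in [set: {set 'I_n}])
    \bigcup_(S' in [set S' | Z S S']) (rej @^-1` [set S] `&` rej' @^-1` [set S'])).
  apply: fin_bigcup_measurable => // S _; apply: fin_bigcup_measurable => // S' _.
  by apply: measurableI; exact: mtp_measurable.
apply/seteqP; split=> [y Zy|y [S _ [S' Z' [/= -> ->]]]//].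
by exists (rej y) => //; exists (rej' y).
Qed.

Lemma measurable_ray_lt (a : R) : measurable [set x : R | x < a].
Proof. by rewrite -set_itvNyo; exact: measurable_itv. Qed.

Lemma measurable_ray_gt (a : R) : measurable [set x : R | a < x].
Proof. by rewrite -set_itvoy; exact: measurable_itv. Qed.

Lemma measurable_dist_le (th a : R) : measurable [set x : R | `|x - th| <= a].
Proof.
apply: measurable_le_cst; apply: (measurableT_comp (@normr_measurable R setT)).
exact: measurable_funB.
Qed.

Lemma measurable_dist_gt (th a : R) : measurable [set x : R | a < `|x - th|].
Proof.
rewrite (_ : [set x | _] = ~` [set x | `|x - th| <= a]).
  by apply: measurableC; exact: measurable_dist_le.
by apply/seteqP; split=> x /=; rewrite ltNge => /negP.
Qed.

Lemma measurable_majority (C : pred R) : measurable [set x | C x] ->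
  measurable [set y : n.-tuple R | majority C y].
Proof.
move=> mC; apply: (measurable_set_valued (F := fun y : n.-tuple R =>
  [set j | C (tnth y j)]%SET) _ (fun S => n./2 < #|S|)%N) => j.
rewrite (_ : [set y | _] = setT `&`
    (fun y : n.-tuple R => tnth y j) @^-1` [set x | C x]).
  exact: measurable_tnth.
by rewrite setTI; apply/seteqP; split => y /=; rewrite finset.inE.
Qed.

Lemma measurable_good_sample (th s d : R) :
  measurable [set y : n.-tuple R | good_sample th s d y].
Proof.
rewrite (_ : [set y | _] =
    [set y | majority (fun x => x < th + s * d) y] `&`
   ([set y | majority (fun x => th - s * d < x) y] `&`
   ([set y | majority (fun x => `|x - th| <= s * (quartile + d)) y] `&`
    [set y | majority (fun x => s * (quartile - d) < `|x - th|) y]))).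
  apply: measurableI; first by apply: measurable_majority; exact: measurable_ray_lt.
  apply: measurableI; first by apply: measurable_majority; exact: measurable_ray_gt.
  apply: measurableI; first by apply: measurable_majority; exact: measurable_dist_le.
  by apply: measurable_majority; exact: measurable_dist_gt.
apply/seteqP; split=> y /=; first by move=> /and4P[].
by move=> [? [? []]] *; apply/and4P.
Qed.

End measurability.

Section chernoff.
Context {R : realType} {n : nat}.
Implicit Types (y : n.-tuple R) (A : {set 'I_n}) (i j : 'I_n) (l q : R).
Variables (P : probability (n.-tuple R) R) (Q : probability (measurableTypeR R) R).
Hypothesis Pprod : product_law P.
Variable A0 : {set 'I_n}.
Hypothesis PA0 : forall i, i \in A0 ->
  forall C : set R, measurable C -> marginal P i C = Q C.
Variable B : pred R.
Hypothesis mB : measurable [set x | B x].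

Let w l (x : R) : R := expR (- l * (B x)%:R).

Lemma measurable_pred_weight l : measurable_fun [set: R] (w l).
Proof.
apply: measurableT_comp => //; apply: measurable_funM => //.
rewrite (_ : (fun _ => _) = \1_[set x | B x]).
  exact: measurable_indic.
apply/funext => x; rewrite indicE; congr (_ %:R); congr nat_of_bool.
by apply/idP/idP => [Bx|/set_mem//]; rewrite mem_set.
Qed.

(** The exponential moment of a Bernoulli variable with parameter at least
    [q]. *)
Lemma integral_pred_weight l q : 0 <= l -> (q%:E <= Q [set x | B x])%E ->
  (\int[Q]_t (w l t)%:E <= (1 - q * (1 - expR (- l)))%:E)%E.
Proof.
move=> l0 qB; set c := 1 - expR (- l).
have c0 : 0 <= c by rewrite subr_ge0 -expR0 ler_expR oppr_le0.
have mBC : measurable (~` [set x | B x]) by exact: measurableC.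
have wE t : (w l t)%:E = ((expR (- l))%:E + c%:E * (\1_(~` [set x | B x]) t)%:E)%E.
  rewrite -EFinM -EFinD; congr (_%:E); rewrite /w indicE /c.
  have [Bt|Bt] := boolP (B t).
    by rewrite memNset ?mulr0 ?addr0 ?mulr1//; apply.
  rewrite mem_set; first by rewrite !mulr1 mulr0 expR0 subrKC.
  exact/negP.
under eq_integral do rewrite wE.
rewrite ge0_integralD//=; last 2 first.
- by move=> t _; rewrite mule_ge0// lee_fin.
- apply: measurable_funeM; apply/measurable_EFinP; exact: measurable_indic.
rewrite prob_integral_cst.
rewrite ge0_integralZl//; last first.
- by apply/measurable_EFinP; exact: measurable_indic.
rewrite prob_integral_indic// probability_setC//.
have QBE : Q [set x | B x] = (fine (Q [set x | B x]))%:E.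
  by rewrite fineK// fin_num_measure.
rewrite QBE lee_fin in qB; rewrite QBE -EFinB -EFinM -EFinD lee_fin /c.
rewrite /c in c0; nra.
Qed.

Lemma measurable_prod_weight l A : measurable_fun setT
  (fun y : n.-tuple R => (\prod_(j in A) w l (tnth y j))%:E).
Proof.
apply/measurable_EFinP; under eq_fun do rewrite big_mkcond/=.
apply: measurable_prod => j; case: (j \in A) => // _.
apply: (measurableT_comp (measurable_pred_weight l)); exact: measurable_tnth.
Qed.

(** Integrating the coordinates out one at a time. *)
Lemma integral_prod_weight l r A : A \subset A0 -> 0 <= r ->
  (\int[Q]_t (w l t)%:E <= r%:E)%E ->
  (\int[P]_y (\prod_(i in A) w l (tnth y i))%:E <= (r ^+ #|A|)%:E)%E.
Proof.
move=> + r0 wr; move En : #|A| => m; elim: m A En => [|m IH] A Am AA0.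
  have -> : A = finset.set0 by apply/eqP; rewrite -cards_eq0 Am.
  under eq_integral do rewrite big_set0.
  by rewrite prob_integral_cst expr0.
have [i iA] : exists i, i \in A by apply/card_gt0P; rewrite Am.
have iA0 : i \in A0 by exact: (fintype.subsetP AA0).
pose A' := (A :\ i)%SET.
have A'm : #|A'| = m by apply/eqP; rewrite -eqSS -Am (cardsD1 i A) iA.
have mprod := measurable_prod_weight l.
have w0 x : 0 <= w l x by exact: expR_ge0.
have prod0 (D : {set 'I_n}) y : 0 <= \prod_(j in D) w l (tnth y j).
  by apply: prodr_ge0.
rewrite (resample_integral Pprod (PA0 iA0))//; last by move=> y; rewrite lee_fin.
have inner y : (\int[Q]_t (\prod_(j in A) w l (tnth (update i y t) j))%:E =
    (\prod_(j in A') w l (tnth y j))%:E * \int[Q]_t (w l t)%:E)%E.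
  have E t : (\prod_(j in A) w l (tnth (update i y t) j))%:E =
      ((\prod_(j in A') w l (tnth y j))%:E * (w l t)%:E)%E.
    rewrite -EFinM (big_setD1 i)//= tnth_mktuple eqxx mulrC; congr ((_ * _)%:E).
    apply: eq_bigr => j; rewrite !finset.inE => /andP[ji _].
    by rewrite tnth_mktuple (negbTE ji).
  under eq_integral do rewrite E.
  rewrite ge0_integralZl//=; last 3 first.
  - by apply/measurable_EFinP; exact: measurable_pred_weight.
  - by move=> t _; rewrite lee_fin.
  - by rewrite lee_fin.
under eq_integral do rewrite inner.
rewrite ge0_integralZr//; last 2 first.
- by move=> y _; rewrite lee_fin.
- by apply: integral_ge0 => t _; rewrite lee_fin.
rewrite exprSr EFinM; apply: lee_pmul => //.
- by apply: integral_ge0 => y _; rewrite lee_fin.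
- by apply: integral_ge0 => t _; rewrite lee_fin.
apply: IH => //; apply: fintype.subset_trans AA0; exact: subD1set.
Qed.

(** The integrand of Markov's inequality: when the event fails to have a
    majority, at most half of the coordinates contribute a factor
    [expR (- l)]. *)
Lemma majority_weight l A y : 0 <= l -> ~~ majority B y ->
  expR (- l * (n%:R / 2)) <= \prod_(i in A) w l (tnth y i).
Proof.
move=> l0; rewrite -leqNgt => M.
rewrite /w -expR_sum ler_expR -mulr_sumr !mulNr lerN2; apply: ler_wpM2l => //.
rewrite -natr_sum; apply: (@le_trans _ _ (n./2)%:R); last first.
  by rewrite ler_pdivlMr// -natrM ler_nat muln2 -[leqRHS]odd_double_half leq_addl.
rewrite ler_nat (leq_trans _ M)// -sum1dep_card [leqRHS]big_mkcond/=.
by rewrite big_mkcond leq_sum// => i _; case: (i \in A); case: (B _).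
Qed.

Lemma majority_failure l r : 0 <= l -> 0 <= r ->
  (\int[Q]_t (w l t)%:E <= r%:E)%E ->
  (P [set y | ~~ majority B y] <= (expR (l * (n%:R / 2)) * r ^+ #|A0|)%:E)%E.
Proof.
move=> l0 r0 wr; set E := [set y | _].
have mE : measurable E by apply: measurable_negb; exact: measurable_majority.
have e0 := expR_gt0 (- l * (n%:R / 2)).
have H : ((expR (- l * (n%:R / 2)))%:E * P E <= (r ^+ #|A0|)%:E)%E.
  apply: le_trans (integral_prod_weight (fintype.subxx A0) r0 wr).
  rewrite -prob_integral_indic// -ge0_integralZl//; last first.
    by apply/measurable_EFinP; exact: measurable_indic.
  apply: ge0_le_integral => //.
  - by apply: measurable_funeM; apply/measurable_EFinP; exact: measurable_indic.
  - exact: measurable_prod_weight.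
  - move=> y _; rewrite -EFinM lee_fin indicE.
    have [/set_mem Ey|_] := boolP (y \in E); first by rewrite mulr1 majority_weight.
    by rewrite mulr0 prodr_ge0// => i _; exact: expR_ge0.
have PE : P E = (fine (P E))%:E by rewrite fineK// fin_num_measure.
rewrite PE -EFinM lee_fin in H *; rewrite PE lee_fin.
rewrite -ler_pdivrMl ?expR_gt0// -expRN -mulNr; exact: H.
Qed.

End chernoff.

Section majority_tail.
Context {R : realType} {n : nat}.
Implicit Types (kap k : R).

(** The choice [l = kap] of the exponential parameter. The mean excess over
    one half is [3 * kap], of which at most [kap] is lost to the nonnull
    coordinates; the linear gain [2 * kap * l * n] exceeds the quadratic loss
    [l ^+ 2 * n]. *)
Lemma chernoff_exponent kap (a : nat) : 0 <= kap <= 1 / 6 ->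
  n%:R * (1 - kap) <= a%:R -> (a <= n)%N ->
  expR (kap * (n%:R / 2)) *
    (1 - (1 / 2 + 3 * kap) * (1 - expR (- kap))) ^+ a
  <= expR (- (n%:R * kap ^+ 2)) :> R.
Proof.
move=> /andP[k0 k6] na an.
have aR : a%:R <= n%:R :> R by rewrite ler_nat.
set q := 1 / 2 + 3 * kap.
have e1 : expR (- kap) <= 1 - kap + kap ^+ 2.
  rewrite expRN; apply: (@le_trans _ _ (1 + kap)^-1).
    by rewrite lef_pV2 ?posrE ?expR_gt0 ?expR_ge1Dx//; lra.
  by rewrite -[leLHS]mul1r ler_pdivrMr; [nra|lra].
have e2 : expR (- kap) <= 1 by rewrite -[leRHS]expR0 ler_expR; lra.
have r0 : 0 <= 1 - q * (1 - expR (- kap)).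
  have := expR_gt0 (- kap); rewrite /q; nra.
have rq : 1 - q * (1 - expR (- kap)) <= expR (- q * (kap - kap ^+ 2)).
  apply: le_trans (expR_ge1Dx _); rewrite /q; nra.
apply: (@le_trans _ _ (expR (kap * (n%:R / 2)) *
    expR (- q * (kap - kap ^+ 2)) ^+ a)).
  by apply: ler_wpM2l; [exact: expR_ge0|apply: lerXn2r; rewrite ?nnegrE ?expR_ge0].
rewrite -expRM_natr -expRD ler_expR /q.
set N := n%:R in na aR *; set A := a%:R in na aR *.
have H1 : N * (1 - kap) * (1 / 2 + 3 * kap) <= A * (1 / 2 + 3 * kap).
  by apply: ler_wpM2r => //; lra.
have N0 : 0 <= N by rewrite /N ler0n.
have H2 : N * (1 / 2 + 2 * kap) <= A * (1 / 2 + 3 * kap).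
  apply: le_trans H1; nra.
have H3 : A * (1 / 2 + 3 * kap) <= N by nra.
nra.
Qed.

Lemma majority_tail (P : probability (n.-tuple R) R)
    (Q : probability (measurableTypeR R) R) (A0 : {set 'I_n}) (B : pred R) kap :
  product_law P ->
  (forall i, i \in A0 ->
    forall C : set R, measurable C -> marginal P i C = Q C) ->
  measurable [set x | B x] -> 0 <= kap <= 1 / 6 ->
  n%:R * (1 - kap) <= #|A0|%:R ->
  ((1 / 2 + 3 * kap)%:E <= Q [set x | B x])%E ->
  (P [set y | ~~ majority B y] <= (expR (- (n%:R * kap ^+ 2)))%:E)%E.
Proof.
move=> Pprod PA0 mB kap6 A0n QB; have /andP[k0 k6] := kap6.
have e2 : expR (- kap) <= 1 by rewrite -[leRHS]expR0 ler_expR; lra.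
apply: (le_trans (majority_failure Pprod PA0 mB k0 _ (integral_pred_weight mB k0 QB))).
  have := expR_gt0 (- kap); nra.
rewrite lee_fin; apply: chernoff_exponent => //.
by rewrite -[leqRHS]card_ord max_card.
Qed.
End majority_tail.

(** * Bad samples are rare *)

Section laws.
Context {R : realType} {n : nat}.
Variable P : probability (n.-tuple R) R.
Hypothesis PC : contaminated_law P.

Lemma null_sigma_gt0 : 0 < null_sigma P.
Proof.
rewrite /null_sigma /null_theta_sigma; case: xgetP => [ts -> []//|H].
by case: PC => _ [ts /H].
Qed.

Lemma marginal_H0 i : i \in H0 P -> forall C : set R, measurable C ->
  marginal P i C = normal_prob (null_theta P) (null_sigma P) C.
Proof. by rewrite finset.inE => /asboolP. Qed.

Lemma card_H0 : #|H0 P|%:R = n%:R - (n1 P)%:R :> R.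
Proof.
have : (#|H0 P| + n1 P = n)%N by rewrite /n1 /H1 cardsC card_ord.
by move/(congr1 (fun m => m%:R : R)); rewrite natrD => <-; rewrite addrK.
Qed.

(** A union bound over the four majorities. *)
Lemma bad_sample_tail (kap d : R) : 0 <= kap <= 1 / 6 -> 0 <= d < 1 / 4 ->
  3 * kap <= slope * d -> (n1 P)%:R <= n%:R * kap ->
  (P [set y | ~~ good_sample (null_theta P) (null_sigma P) d y] <=
   (4 * expR (- (n%:R * kap ^+ 2)))%:E)%E.
Proof.
move=> kap6 /andP[d0 d4] kd n1k; have s0 := null_sigma_gt0.
set th := null_theta P; set s := null_sigma P.
have [Pprod _] := PC.
have An : n%:R * (1 - kap) <= #|H0 P|%:R :> R by rewrite card_H0; lra.
have tail (B : pred R) : measurable [set x | B x] ->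
    ((1 / 2 + slope * d)%:E <= normal_prob th s [set x | B x])%E ->
    (P [set y | ~~ majority B y] <= (expR (- (n%:R * kap ^+ 2)))%:E)%E.
  move=> mB HB; apply: (majority_tail Pprod marginal_H0 mB kap6 An).
  by apply: le_trans HB; rewrite lee_fin; lra.
pose M1 := fun x : R => x < th + s * d.
pose M2 := fun x : R => th - s * d < x.
pose M3 := fun x : R => `|x - th| <= s * (quartile + d).
pose M4 := fun x : R => s * (quartile - d) < `|x - th|.
have m1 : measurable [set x | M1 x] by exact: measurable_ray_lt.
have m2 : measurable [set x | M2 x] by exact: measurable_ray_gt.
have m3 : measurable [set x | M3 x] by exact: measurable_dist_le.
have m4 : measurable [set x | M4 x] by exact: measurable_dist_gt.
have mfail (B : pred R) : measurable [set x | B x] ->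
    measurable [set y : n.-tuple R | ~~ majority B y].
  by move=> mB; apply: measurable_negb; exact: measurable_majority.
rewrite (_ : [set y | _] = [set y | ~~ majority M1 y] `|`
   ([set y | ~~ majority M2 y] `|`
   ([set y | ~~ majority M3 y] `|` [set y | ~~ majority M4 y]))); last first.
  apply/seteqP; split=> y /=; rewrite /good_sample !negb_and.
    by move=> /or4P[]; [left|right;left|right;right;left|right;right;right].
  by move=> [|[|[|]]] H; apply/or4P; [exact: Or41|exact: Or42|exact: Or43|exact: Or44].
have t1 := tail _ m1 (normal_mass_below th s0 d0 d4).
have t2 := tail _ m2 (normal_mass_above th s0 d0 d4).
have t3 := tail _ m3 (normal_mass_centre th s0 d0 d4).
have t4 := tail _ m4 (normal_mass_off_centre th s0 d0 d4).
set e := expR _ in t1 t2 t3 t4 *.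
have -> : 4 * e = e + (e + (e + e)) by ring.
rewrite !EFinD.
do 3! (apply: le_trans (measureU2 _ _ _) _; [exact: mfail|
  by do ?[apply: measurableU]; exact: mfail|]; apply: leeD => //).
Qed.
End laws.

(** * False discoveries of the plug-in procedure *)

Local Notation plugin_BH alpha y := (BH alpha y (theta_tilde y) (sigma_tilde y)).

Section quantiles.
Context {R : realType} (n : nat).
Implicit Types (alpha : R).

(** The level [alpha * r / n] lies between [alpha / n] and 1/2, so it has a
    nonnegative quantile, at most of order the square root of the logarithm. *)
Lemma rejection_quantile alpha (r : nat) : 0 < alpha < 1 / 2 ->
  1 <= ln (n%:R / alpha) -> (0 < r <= n)%N ->
  exists z, [/\ 0 <= z, 2 * gauss_tail z = alpha * r%:R / n%:R &
                (1 + z) ^+ 2 <= 10 * ln (n%:R / alpha)].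
Proof.
move=> /andP[a0 a2] L1 /andP[r0 rn].
have n0 : 0 < n%:R :> R by rewrite ltr0n; lia.
have n1 : 1 <= n%:R :> R by rewrite (ler_nat _ 1); lia.
have r1 : 1 <= r%:R :> R by rewrite (ler_nat _ 1).
have rN : r%:R <= n%:R :> R by rewrite ler_nat.
have tau1 : alpha / n%:R <= alpha * r%:R / n%:R.
  by rewrite ler_pM2r ?invr_gt0//; nra.
have tau2 : alpha * r%:R / n%:R <= alpha by rewrite ler_pdivrMr//; nra.
have tau0 : 0 < alpha / n%:R by rewrite divr_gt0.
have [z z0 Tz] : exists2 z, 0 <= z & gauss_tail z = alpha * r%:R / n%:R / 2.
  by apply: gauss_tail_surj; apply/andP; split; lra.
exists z; split=> //; first by rewrite Tz; field; rewrite gt_eqF.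
apply: quantile_sqr_bound => //; first lra.
rewrite Tz invfM mulrCA mulrC; lra.
Qed.

End quantiles.

Lemma rejected_tail (R : realType) n (alpha : R) (y : n.-tuple R) i x z :
  0 < alpha -> i \in plugin_BH alpha y -> tnth y i = x ->
  2 * gauss_tail z = alpha * #|plugin_BH alpha y|%:R / n%:R ->
  gauss_tail (`|x - theta_tilde y| / sigma_tilde y) <= gauss_tail z.
Proof.
move=> a0 iR <- Tz; have /= H := bh_self_consistent a0 iR.
rewrite -(ler_pM2l (ltr0n R 2)) Tz; exact: H.
Qed.

Lemma indic_mem (R : pzRingType) (T : Type) (A : set T) t : A t -> \1_A t = 1 :> R.
Proof. by move=> At; rewrite indicE mem_set. Qed.

Section null_coordinate.
Context {R : realType} {n : nat}.
Variables (th s d alpha : R).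
Hypothesis s0 : 0 < s.
Hypothesis a12 : 0 < alpha < 1 / 2.
Hypothesis d8 : 0 <= d < 1 / 8.
Let L := ln (n%:R / alpha).
Hypothesis L1 : 1 <= L.
Let b := 8 * d * (10 * L).
Hypothesis b1 : b <= 1.
Let eta := expR (5 / 2) * b.
Implicit Types (y : n.-tuple R) (i : 'I_n) (t : R).

Let good y := good_sample th s d y.

(** The contribution of coordinate [i] to the false discovery proportion, cut
    off on bad samples. *)
Definition fdp_term i y : R :=
  (good y)%:R * ((i \in plugin_BH alpha y)%:R / (maxn #|plugin_BH alpha y| 1)%:R).

Lemma fdp_term_ge0 i y : 0 <= fdp_term i y.
Proof. by rewrite /fdp_term mulr_ge0// divr_ge0. Qed.

Lemma fdp_term_le i y : fdp_term i y <= #|plugin_BH alpha y|%:R^-1.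
Proof.
rewrite /fdp_term; case: (good y); last by rewrite mul0r invr_ge0.
have [iR|] := boolP (i \in _); last by rewrite mul0r mulr0 invr_ge0.
have /maxn_idPl-> : (0 < #|plugin_BH alpha y|)%N by apply/card_gt0P; exists i.
by rewrite !mul1r.
Qed.

(** On one side of the median and with the other coordinates fixed, the number
    of rejections is a constant [r] as long as coordinate [i] is rejected.
    Hence the contribution is at most [r^-1] times the indicator of a fixed
    tail, whose mass is close to half of [alpha * r / n]: the factor [r]
    cancels. The tail is abstract so that the two sides share the proof. *)
Lemma fdp_term_side (side : rel R) (tail : R -> set R) i y :
  (forall x, measurable (tail x)) ->
  (forall x, normal_prob th s (tail x) = (gauss_tail x)%:E) ->
  (forall u v z t, 0 < v -> 0 <= z -> `|u - th| <= s * (8 * d) ->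
    `|v - s| <= s * (8 * d) -> side u t ->
    gauss_tail (`|t - u| / v) <= gauss_tail z ->
    tail (z - 8 * d * (1 + z)) t) ->
  (forall u t u' t', side u t -> side u' t' ->
    (u < t /\ u' < t') \/ (t < u /\ t' < u')) ->
  exists c (A : set R), [/\ measurable A, 0 <= c,
    (c%:E * normal_prob th s A <= (alpha * (1 + eta) / n%:R / 2)%:E)%E &
    forall t, side (theta_tilde (update i y t)) t ->
      fdp_term i (update i y t) <= c * \1_A t].
Proof.
move=> mtail tailE sub_tail same_side.
(* The positions at which coordinate [i] contributes. *)
pose S := [set t | [/\ good (update i y t),
  i \in plugin_BH alpha (update i y t) & side (theta_tilde (update i y t)) t]].
have n0 := ord_size_gt0 R i; have /andP[a0 _] := a12; have /andP[d0 _] := d8.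
have L1' := L1; have b0 : 0 <= b by rewrite /b !mulr_ge0//; lra.
have eta0 : 0 <= eta by rewrite /eta mulr_ge0 ?expR_ge0.
have termE t : side (theta_tilde (update i y t)) t ->
    fdp_term i (update i y t) != 0 -> S t.
  move=> tt; rewrite /fdp_term /S/=.
  case: (good _) => /=; last by rewrite mul0r eqxx.
  by case: (i \in _) => //=; rewrite mul0r mulr0 eqxx.
(* Unless there are none, any of them, [t0], determines [r] and the tail. *)
have [S0|/set0P[t0 [g0 iR0 tt0]]] := eqVneq S set0.
  exists 0, setT; split=> //.
    by rewrite mul0e lee_fin !mulr_ge0 ?invr_ge0//; lra.
  move=> t tt; rewrite mul0r leNgt; apply/negP => /lt0r_neq0/(termE _ tt).
  by rewrite S0.
set y0 := update i y t0 in g0 iR0 tt0.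
set r := #|plugin_BH alpha y0|.
have r0n := nonempty_card_range iR0.
have [z [z0 Tz zL]] := rejection_quantile a12 L1 r0n.
have [uth vs v0] := good_sample_estimators s0 d8 g0.
pose h := 8 * d * (1 + z).
exists (r%:R^-1), (tail (z - h)); split=> //.
- have r0 : 0 < r%:R :> R by rewrite ltr0n; case/andP: r0n.
  rewrite tailE -EFinM lee_fin.
  rewrite mulrC ler_pdivrMr//.
  have h0 : 0 <= h by rewrite /h !mulr_ge0//; lra.
  have hb : h * (1 + z) <= b.
    by rewrite /h /b -mulrA -expr2; apply: ler_wpM2l => //; lra.
  apply: le_trans (gauss_tail_ratio_left z0 h0 hb b1) _.
  rewrite -/eta; have -> : gauss_tail z = alpha * r%:R / n%:R / 2.
    by rewrite -Tz; field.
  by rewrite le_eqVlt; apply/orP; left; apply/eqP; field; rewrite gt_eqF.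
- move=> t tt; have [->|f0] := eqVneq (fdp_term i (update i y t)) 0.
    by rewrite mulr_ge0// invr_ge0.
  have [gt iRt _] := termE _ tt f0.
  have [uth' vs' v0'] := good_sample_estimators s0 d8 gt.
  have tnthi u : tnth (update i y u) i = u by rewrite tnth_mktuple eqxx.
  have [uE vE RE] : [/\ theta_tilde (update i y t) = theta_tilde y0,
      sigma_tilde (update i y t) = sigma_tilde y0 &
      plugin_BH alpha (update i y t) = plugin_BH alpha y0].
    apply: (@BH_leave_one_out _ _ _ _ _ i a12 _ v0' v0 iRt iR0).
      by move=> j /negbTE ji; rewrite !tnth_mktuple ji.
    by rewrite !tnthi; exact: same_side.
  have cE : #|plugin_BH alpha (update i y t)| = r by rewrite /r -RE.
  have tz : tail (z - h) t.
    apply: (sub_tail _ _ _ _ v0' z0 uth' vs' tt).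
    by apply: (rejected_tail a0 iRt (tnthi t)); rewrite cE.
  by rewrite (indic_mem R tz) mulr1 -cE; exact: fdp_term_le.
Qed.

Lemma theta_tilde_neq_rejected i y : i \in plugin_BH alpha y ->
  theta_tilde y != tnth y i.
Proof.
have /andP[a0 a2] := a12; move=> /(bh_rejection_le a0); rewrite /pvalue => pa.
apply/negP => /eqP E; move: pa; rewrite E subrr normr0 mul0r gauss_tail0; lra.
Qed.

(** The two sides of the median contribute half of the level each. *)
Lemma fdp_term_integral i y :
  measurable_fun setT (fun t : measurableTypeR R => fdp_term i (update i y t)) ->
  (\int[normal_prob th s]_t (fdp_term i (update i y t))%:E <=
   (alpha * (1 + eta) / n%:R)%:E)%E.
Proof.
move=> mf.
have [c1 [A1 [mA1 c10 QA1 f1]]] : exists c (A : set R), [/\ measurable A, 0 <= c,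
    (c%:E * normal_prob th s A <= (alpha * (1 + eta) / n%:R / 2)%:E)%E &
    forall t, theta_tilde (update i y t) < t ->
      fdp_term i (update i y t) <= c * \1_A t].
  apply: (@fdp_term_side (fun u t => u < t) (fun x => `[th + s * x, +oo[%classic)).
  - by move=> x; exact: measurable_itv.
  - by move=> x; rewrite -normal_prob_obnd_cbnd; exact: normal_prob_right.
  - move=> u v z t v0 z0 uth vs ut Tz; rewrite /= in_itv/= andbT.
    exact: (plugin_tail_right s0 v0 z0 uth vs ut Tz).
  - by move=> *; left.
have [c2 [A2 [mA2 c20 QA2 f2]]] : exists c (A : set R), [/\ measurable A, 0 <= c,
    (c%:E * normal_prob th s A <= (alpha * (1 + eta) / n%:R / 2)%:E)%E &
    forall t, t < theta_tilde (update i y t) ->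
      fdp_term i (update i y t) <= c * \1_A t].
  apply: (@fdp_term_side (fun u t => t < u) (fun x => `]-oo, th - s * x]%classic)).
  - by move=> x; exact: measurable_itv.
  - by move=> x; rewrite -normal_prob_bndo_bndc; exact: normal_prob_left.
  - move=> u v z t v0 z0 uth vs ut Tz; rewrite /= in_itv/=.
    exact: (plugin_tail_left s0 v0 z0 uth vs ut Tz).
  - by move=> *; right.
have mterm c (A : set R) : measurable A ->
    measurable_fun setT (fun t : measurableTypeR R => (c%:E * (\1_A t)%:E)%E).
  move=> mA; apply: measurable_funeM; apply/measurable_EFinP.
  exact: measurable_indic.
apply: (@le_trans _ _ (\int[normal_prob th s]_t
    (c1%:E * (\1_A1 t)%:E + c2%:E * (\1_A2 t)%:E))%E).
  apply: ge0_le_integral => //.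
  - by move=> t _; rewrite lee_fin fdp_term_ge0.
  - exact/measurable_EFinP.
  - by apply: emeasurable_funD; exact: mterm.
  - move=> t _; rewrite -!EFinM -EFinD lee_fin.
    have p1 : 0 <= c1 * \1_A1 t by rewrite mulr_ge0.
    have p2 : 0 <= c2 * \1_A2 t by rewrite mulr_ge0.
    have [iR|iR] := boolP (i \in plugin_BH alpha (update i y t)); last first.
      by rewrite /fdp_term (negbTE iR) mul0r mulr0 addr_ge0.
    have := theta_tilde_neq_rejected iR; rewrite tnth_mktuple eqxx neq_lt.
    move=> /orP[/f1|/f2] H; apply: (le_trans H); lra.
have c1e : (0 <= c1%:E)%E by rewrite lee_fin.
have c2e : (0 <= c2%:E)%E by rewrite lee_fin.
rewrite ge0_integralD//; [|by move=> t _; rewrite mule_ge0// lee_fin|exact: mterm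
  |by move=> t _; rewrite mule_ge0// lee_fin|exact: mterm].
have int1 c (A : set R) : measurable A -> (0 <= c%:E)%E ->
    (\int[normal_prob th s]_t (c%:E * (\1_A t)%:E) = c%:E * normal_prob th s A)%E.
  move=> mA c0e; rewrite ge0_integralZl//.
    by rewrite prob_integral_indic.
  by apply/measurable_EFinP; exact: measurable_indic.
rewrite !int1//; apply: (le_trans (leeD QA1 QA2)).
by rewrite -EFinD lee_fin; lra.
Qed.

End null_coordinate.

Lemma TDP_mono (R : realType) n (P : probability (n.-tuple R) R)
  (A B : {set 'I_n}) : A \subset B -> TDP P A <= TDP P B.
Proof.
move=> AB; rewrite /TDP ler_pM2r ?invr_gt0 ?ltr0n ?leq_max ?orbT//.
by rewrite ler_nat subset_leq_card// finset.setSI.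
Qed.

Section risks.
Context {R : realType} {n : nat}.
Variable P : probability (n.-tuple R) R.
Hypothesis PC : contaminated_law P.
Variables (d alpha : R).
Hypothesis a12 : 0 < alpha < 1 / 2.
Hypothesis d8 : 0 < d < 1 / 8.
Let L := ln (n%:R / alpha).
Hypothesis L1 : 1 <= L.
Let b := 8 * d * (10 * L).
Hypothesis b1 : b <= 1.
Let eta := expR (5 / 2) * b.
Hypothesis eta1 : eta < 1.
Implicit Types (y : n.-tuple R) (i : 'I_n) (t : R).

Let th := null_theta P.
Let s := null_sigma P.
Let good y := good_sample th s d y.
Let plugin := BH_mtp alpha (@theta_tilde R n) (@sigma_tilde R n).
Let term i y := fdp_term th s d alpha i y.

(** The oracle rejection set at the smaller level is self-consistent for the
    plug-in p-values, so the plug-in procedure contains it by maximality. *)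
Lemma oracle_sub_plugin y : good y ->
  BH (alpha * (1 - eta)) y th s \subset plugin_BH alpha y.
Proof.
move=> gy; have s0 : 0 < s := null_sigma_gt0 PC.
have /andP[a0 a2] := a12; have /andP[d0 dlt] := d8.
have d8' : 0 <= d < 1 / 8 by rewrite ltW.
have [uth vs v0] := good_sample_estimators s0 d8' gy.
have a01 : 0 < alpha < 1 by rewrite a0/=; lra.
have e1 : 0 < 1 - eta by rewrite subr_gt0; exact: eta1.
set S := BH (alpha * (1 - eta)) y th s.
apply: (bh_maximal a01) => i iS.
have r0n := nonempty_card_range iS.
have [z [z0 Tz zL]] := rejection_quantile a12 L1 r0n.
have L0 : 0 < L := lt_le_trans ltr01 L1.
have b0 : 0 < b by rewrite /b !mulr_gt0.
have pS : pvalue y th s i <= alpha * (1 - eta) * #|S|%:R / n%:R.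
  by apply: bh_self_consistent iS; rewrite mulr_gt0.
have r0 : 0 < #|S|%:R :> R by rewrite ltr0n; case/andP: r0n.
have n0 := ord_size_gt0 R i.
have T0 : 0 < gauss_tail z.
  rewrite -(pmulr_rgt0 _ (ltr0n R 2)) Tz; apply: divr_gt0 => //.
  exact: mulr_gt0.
have db : 8 * d * (1 + z) ^+ 2 <= b.
  by rewrite /b; apply: ler_wpM2l => //; rewrite mulr_ge0// ltW.
have be : expR (3 / 2) * b < eta.
  by rewrite /eta ltr_pM2r// ltr_expR; lra.
have d80 : 0 <= 8 * d by rewrite mulr_ge0// ltW.
rewrite /pvalue -Tz ler_pM2l//.
apply: (plugin_tail_oracle s0 v0 z0 d80 db be uth vs T0).
rewrite -(ler_pM2l (ltr0n R 2)) mulrCA Tz; apply: le_trans pS _.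
by rewrite le_eqVlt; apply/orP; left; apply/eqP; ring.
Qed.

Let mgood : measurable [set y : n.-tuple R | good y].
Proof. exact: measurable_good_sample. Qed.

Lemma measurable_fdp_term i : measurable_fun setT (term i).
Proof.
rewrite (_ : term i = fun y => \1_[set y | good y] y *
    ((i \in plugin y)%:R / (maxn #|plugin y| 1)%:R)).
  apply: measurable_funM; first exact: measurable_indic.
  exact: (measurable_mtp_comp plugin
    (fun S : {set 'I_n} => (i \in S)%:R / (maxn #|S| 1)%:R)).
apply/funext => y; rewrite /term /fdp_term indicE; congr (_ %:R * _).
congr nat_of_bool; apply/idP/idP => [g|/set_mem//]; exact: mem_set.
Qed.

Lemma fdp_term_expectation i : i \in H0 P ->
  (\int[P]_y (term i y)%:E <= (alpha * (1 + eta) / n%:R)%:E)%E.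
Proof.
move=> iH0; have s0 : 0 < s := null_sigma_gt0 PC; have [Pprod _] := PC.
have d8' : 0 <= d < 1 / 8 by case/andP: d8 => d0 ->; rewrite ltW.
have mt : measurable_fun setT (EFin \o term i).
  by apply/measurable_EFinP; exact: measurable_fdp_term.
have t0 y : (0 <= (term i y)%:E)%E by rewrite lee_fin fdp_term_ge0.
rewrite (resample_integral Pprod (marginal_H0 iH0) mt t0).
rewrite -[leRHS](prob_integral_cst P).
apply: ge0_le_integral => //.
- by move=> y _; apply: integral_ge0 => t _; exact: t0.
- exact: measurable_resample.
- move=> y _; apply: (fdp_term_integral s0 a12 d8' L1 b1).
  exact: (measurableT_comp (measurable_fdp_term i) (measurable_update_coord i y)).
Qed.

Lemma FDP_le_sum y :
  FDP P (plugin y) <= \sum_(i in H0 P) term i y + (~~ good y)%:R.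
Proof.
have [g|g] := boolP (good y); last first.
  apply: (@le_trans _ _ 1).
    rewrite /FDP ler_pdivrMr ?ltr0n ?leq_max ?orbT// mul1r ler_nat.
    by rewrite leq_max subset_leq_card// finset.subsetIl.
  by rewrite lerDr sumr_ge0// => i _; exact: fdp_term_ge0.
rewrite addr0 /FDP (_ : _ / _ = \sum_(i in H0 P) term i y)//.
rewrite -sum1_card natr_sum mulr_suml.
rewrite (eq_bigl (fun i => (i \in H0 P) && (i \in plugin y))); last first.
  by move=> i; rewrite finset.inE andbC.
rewrite big_mkcondr/=; apply: eq_bigr => i _.
rewrite /term /fdp_term -/(good y) g mul1r.
by case: (i \in _); rewrite mul1r ?mul0r ?mul1r.
Qed.

Lemma FDR_plugin_le :
  (FDR P plugin <= (alpha * (1 + eta))%:E + P [set y | ~~ good y])%E.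
Proof.
have mbad := measurable_negb mgood.
have /andP[a0 _] := a12.
have L0 : 0 < L := lt_le_trans ltr01 L1.
have eta0 : 0 <= eta.
  by rewrite /eta /b !mulr_ge0 ?expR_ge0//; [case/andP: d8 => /ltW|exact: ltW].
have mS : measurable_fun setT (fun y => (\sum_(i in H0 P) (term i y)%:E)%E).
  under eq_fun do rewrite sumEFin big_mkcond/=.
  apply/measurable_EFinP; apply: measurable_sum => i; case: (i \in H0 P) => //.
  exact: measurable_fdp_term.
rewrite /FDR unlock.
apply: (@le_trans _ _ (\int[P]_y (\sum_(i in H0 P) (term i y)%:E +
    (\1_[set y | ~~ good y] y)%:E))%E).
  apply: ge0_le_integral => //.
  - by move=> y _; rewrite lee_fin /FDP divr_ge0.
  - apply/measurable_EFinP; exact: (measurable_mtp_comp plugin (FDP P)).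
  - apply: emeasurable_funD; last by apply/measurable_EFinP; exact: measurable_indic.
    exact: mS.
  - move=> y _; rewrite sumEFin -EFinD lee_fin.
    apply: (le_trans (FDP_le_sum y)); rewrite lerD2l indicE.
    rewrite le_eqVlt; apply/orP; left; apply/eqP; congr (_ %:R).
    by congr nat_of_bool; apply/idP/idP => [H|/set_mem//]; exact: mem_set.
have mE i : measurable_fun setT (fun y => (term i y)%:E).
  by apply/measurable_EFinP; exact: measurable_fdp_term.
have t0 i y : (0 <= (term i y)%:E)%E by rewrite lee_fin fdp_term_ge0.
rewrite ge0_integralD//; first last.
- by apply/measurable_EFinP; exact: measurable_indic.
- by move=> y _; exact: sume_ge0.
apply: leeD; last by rewrite prob_integral_indic.
under eq_integral do rewrite -big_filter.
rewrite ge0_integral_sum// big_filter.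
apply: (@le_trans _ _ (\sum_(i in H0 P) (alpha * (1 + eta) / n%:R)%:E)%E).
  by apply: lee_sum => i iH; exact: fdp_term_expectation.
rewrite sumEFin lee_fin sumr_const.
have [->|/card_gt0P[i _]] := posnP #|H0 P|.
  by rewrite mulr0n mulr_ge0//; lra.
have n0 := ord_size_gt0 R i.
rewrite -mulrnAl ler_pdivrMr// -[leLHS]mulr_natr; apply: ler_wpM2l.
  by rewrite mulr_ge0//; lra.
by rewrite ler_nat -[leqRHS]card_ord max_card.
Qed.

Lemma power_loss_le :
  (P [set y | (TDP P (plugin y) < TDP P (BH_oracle (alpha * (1 - eta)) P y))%R]
   <= P [set y | ~~ good y])%E.
Proof.
have mbad := measurable_negb mgood.
apply: le_measure; rewrite ?inE//.
  exact: (measurable_mtp_rel plugin (BH_oracle (alpha * (1 - eta)) P)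
    (fun S S' => TDP P S < TDP P S')).
move=> y /=; apply: contraTN => g; rewrite -leNgt.
apply: TDP_mono; exact: oracle_sub_plugin.
Qed.

End risks.

(** * Choice of the constants *)

Section calibration.
Context {R : realType}.
(** [64 = 2 ^ 6] makes the sixth root of [n] at least 2, and [expR 1] makes
    [ln (n / alpha)] at least 1. *)
Definition sample_size_bound : R := 64 + expR 1.
(** [240 = 8 * 10 * 3]: the factor 8 from the estimators, 10 from the squared
    quantile, 3 from the excess of mass; [expR (5 / 2)] is the constant of the
    tail ratio. *)
Definition rate_constant : R := 240 * expR (5 / 2) / slope.

Definition contamination (n : nat) (k : R) : R :=
  Num.max (k / n%:R) (n%:R `^ (- (1 / 6))).

(** The scale [d] at which the four masses exceed one half by
    at least [3 * contamination]. *)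
Definition radius (n : nat) (k : R) : R := 3 * contamination n k / slope.

Lemma slope_gt0 : 0 < @slope R.
Proof. exact: std_normal_pdf_gt0. Qed.

Lemma rate_constant_gt0 : 0 < rate_constant.
Proof.
apply: divr_gt0; last exact: slope_gt0.
by apply: mulr_gt0 => //; exact: expR_gt0.
Qed.

Lemma slope_le1 : @slope R <= 1.
Proof. exact: std_normal_pdf_le1. Qed.

Variables (n : nat) (alpha k : R).
Let N : R := n%:R.
Let L := ln (N / alpha).
Let kap := contamination n k.
Let d := radius n k.
Hypothesis Nmin : sample_size_bound <= N.
Hypothesis a12 : 0 < alpha < 1 / 2.
Hypothesis eta1 : rate_constant * L * kap <= 5 / 100.

Lemma sample_size_gt : 64 < N.
Proof. by apply: lt_le_trans Nmin; rewrite /sample_size_bound ltrDl expR_gt0. Qed.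

Lemma log_ge1 : 1 <= L.
Proof.
have N64 := sample_size_gt; have /andP[a0 a2] := a12.
rewrite -[leLHS](expRK 1) /L ler_ln ?posrE ?expR_gt0//; last first.
  by rewrite divr_gt0//; lra.
apply: (@le_trans _ _ N).
  by apply: le_trans Nmin; rewrite /sample_size_bound; lra.
rewrite ler_pdivlMr//; nra.
Qed.

Lemma contamination_gt0 : 0 < kap.
Proof.
rewrite lt_max; apply/orP; right; apply: powR_gt0.
by have := sample_size_gt; lra.
Qed.

(** The bound on the relative error of the tail ratios equals the rate of the
    theorem. *)
Lemma rateE : expR (5 / 2) * (8 * d * (10 * L)) = rate_constant * L * kap.
Proof. by rewrite /d /radius -/kap /rate_constant; field; rewrite gt_eqF// slope_gt0. Qed.

Lemma rate_budget : 8 * d * (10 * L) <= 5 / 100.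
Proof.
have k0 := contamination_gt0; have L1 := log_ge1.
have d0 : 0 < d by rewrite /d /radius -/kap divr_gt0 ?slope_gt0// mulr_gt0.
have d0' := ltW d0; have L0 := le_trans ler01 L1.
apply: le_trans eta1; rewrite -rateE ler_peMl//.
  by apply: mulr_ge0; exact: mulr_ge0.
by rewrite -[leLHS](expR0 R) ler_expR; lra.
Qed.

Lemma radius_range : 0 < d < 1 / 8.
Proof.
have k0 := contamination_gt0; have L1 := log_ge1; have b1 := rate_budget.
have d0 : 0 < d by rewrite /d /radius -/kap divr_gt0 ?slope_gt0// mulr_gt0.
by rewrite d0/=; nra.
Qed.

Lemma slope_radius : 3 * kap = slope * d.
Proof. by rewrite /d /radius -/kap [RHS]mulrC divfK// gt_eqF// slope_gt0. Qed.

Lemma contamination_small : 0 <= kap <= 1 / 6.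
Proof.
have k0 := contamination_gt0; have /andP[d0 d8] := radius_range.
have := slope_radius; have := slope_le1; have := slope_gt0.
by move: k0 d0 d8 => k0 d0 d8 s0 s1 e; rewrite ltW//=; nra.
Qed.

Lemma sparsity_le_contamination : k <= N * kap.
Proof.
have N64 := sample_size_gt.
rewrite mulrC -ler_pdivrMr; first by rewrite le_max lexx.
lra.
Qed.

(** With [x] the sixth root of [n], the exponent [n * kap ^+ 2] is at least
    [x ^+ 4], while the error is [expR (- x ^+ 3)]; the factor 4 is absorbed
    as [x >= 2]. *)
Lemma failure_probability_le :
  4 * expR (- (N * kap ^+ 2)) <= expR (- (N `^ (1 / 2))).
Proof.
have N64 := sample_size_gt; have N0 : 0 <= N by lra.
set x := N `^ (1 / 6).
have x0 : 0 < x by apply: powR_gt0; lra.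
have xE m : N `^ (m%:R / 6) = x ^+ m.
  by rewrite -powR_mulrn ?ltW// -powRrM; congr (_ `^ _); field.
have x6 : N = x ^+ 6.
  by rewrite -xE divff ?powRr1.
have x3 : N `^ (1 / 2) = x ^+ 3.
  by rewrite -xE; congr (_ `^ _); field.
have x2 : 2 <= x.
  rewrite leNgt; apply/negP => xlt.
  have : x ^+ 6 < 2 ^+ 6 by rewrite ltrXn2r// ltW.
  by rewrite -x6; lra.
have kx : x^-1 <= kap by rewrite le_max powRN lexx orbT.
have kx4 : x ^+ 4 <= N * kap ^+ 2.
  rewrite x6 -[x ^+ 4]mulr1 (_ : x ^+ 6 = x ^+ 4 * x ^+ 2); last by ring.
  rewrite -mulrA -exprMn; apply: ler_wpM2l; first by rewrite exprn_ge0// ltW.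
  have : 1 <= x * kap by rewrite -ler_pdivrMl// mulr1.
  nra.
rewrite x3; have e8 : 4 <= expR (8 : R) by apply: le_trans (expR_ge1Dx _); lra.
apply: (@le_trans _ _ (expR 8 * expR (- (N * kap ^+ 2)))).
  by rewrite ler_pM2r ?expR_gt0.
rewrite -expRD ler_expR.
have : x ^+ 3 + 8 <= x ^+ 4.
  have : 8 <= x ^+ 3 by rewrite (_ : 8 = 2 ^+ 3); [rewrite lerXn2r ?nnegrE// ltW|ring].
  rewrite (exprS x 3); set u := x ^+ 3 => u8; nra.
lra.
Qed.

End calibration.

Theorem theorem3p2 (R : realType) :
  exists c1 c2 : R, [/\ 0 < c1, 0 < c2 &
    forall (n : nat) (alpha k : R),
      c1 <= n%:R -> 0 < alpha < 1 / 2 -> 0 < k <= 1 / 10 * n%:R ->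
      let eta := c2 * ln (n%:R / alpha)
                 * Num.max (k / n%:R) (n%:R `^ (- (1 / 6))) in
      eta <= 5 / 100 ->
      let err := expR (- (n%:R `^ (1 / 2))) in
      (riskI (BH_mtp alpha (@theta_tilde R n) (@sigma_tilde R n)) k
         <= (alpha * (1 + eta) + err)%:E)%E /\
      (riskII (BH_mtp alpha (@theta_tilde R n) (@sigma_tilde R n)) k
         (alpha * (1 - eta)) <= err%:E)%E].
Proof.
exists sample_size_bound, rate_constant; split.
- by rewrite /sample_size_bound addr_gt0 ?expR_gt0.
- exact: rate_constant_gt0.
move=> n alpha k Nmin a12 _ eta eta1 err.
have L1 := log_ge1 Nmin a12.
have b5 := rate_budget Nmin a12 eta1.
have b1 : 8 * radius n k * (10 * ln (n%:R / alpha)) <= 1.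
  by apply: le_trans b5 _; lra.
have d8 := radius_range Nmin a12 eta1.
have etaE : expR (5 / 2) * (8 * radius n k * (10 * ln (n%:R / alpha))) = eta.
  exact: rateE.
have bad (P : probability (n.-tuple R) R) : sparse_laws k P ->
    (P [set y | ~~ good_sample (null_theta P) (null_sigma P) (radius n k) y]
      <= err%:E)%E.
  move=> [PC n1k].
  apply: (@le_trans _ _ (4 * expR (- (n%:R * contamination n k ^+ 2)))%:E);
    last by rewrite lee_fin; exact: failure_probability_le.
  apply: bad_sample_tail => //.
  - exact: contamination_small Nmin a12 eta1.
  - by case/andP: d8 => d0 dlt; rewrite ltW//=; lra.
  - by rewrite slope_radius.
  - apply: (le_trans n1k); exact: sparsity_le_contamination.
split; apply: ub_ereal_sup => _ [P Pk <-].
  have [PC _] := Pk.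
  apply: le_trans (FDR_plugin_le PC a12 d8 L1 b1) _.
  by rewrite etaE EFinD; apply: leeD => //; exact: bad.
have [PC _] := Pk.
apply: le_trans (bad P Pk).
have elt : expR (5 / 2) * (8 * radius n k * (10 * ln (n%:R / alpha))) < 1.
  by rewrite etaE; apply: le_lt_trans eta1 _; lra.
by have := power_loss_le PC a12 d8 L1 elt; rewrite etaE.
Qed.
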